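(* Let $T$ be a perfect dyadic Calderón–Zygmund operator, and suppose that for each $P\in\mathbf{P}^+$ there are functions $b^1_P, b^2_P\in S(I_P)$ obeying the normalization $$[b^1_P]_P=[b^2_P]_P=1$$ and the bounds $$\int_{I_P}|b^1_P|^2+|T b^1_P|^2+|b^2_P|^2+|T^*b^2_P|^2\ \lesssim\ |I_P| .$$ Then $T$ is bounded on $L^2$ (that is, $\|Tf\|_2\le C\|f\|_2$ with $C$ depending only on the implied constants in the hypotheses, and not on $M$).
   Context: Fix an integer $M>0$. A dyadic interval is an interval $[j2^k,(j+1)2^k]$ with $j,k$ integers, $-M\le k\le M$, contained in $[0,2^M]$; there are finitely many, and sets of measure zero are ignored. Each dyadic interval $I$ has an associated lacunary tile $P^+(I)=I\times[1/|I|,2/|I|]$; $\mathbf{P}^+$ is the set of all lacunary tiles, and for $P=P^+(I)$ we write $I_P=I$. For a function $f$, $[f]_I=\frac1{|I|}\int_I f$ and $[f]_P=[f]_{I_P}$. Haar functions: for $P\in\mathbf{P}^+$, $\phi_P=|I_P|^{-1/2}(\chi_{I_P^l}-\chi_{I_P^r})$ with $I_P^l,I_P^r$ the left and right halves of $I_P$. The space $S$ of (complex-valued) dyadic test functions is the linear span of all $\phi_P$, $P\in\mathbf{P}^+$, and all $\chi_I$, $I$ dyadic. $S(I)$ is the set of elements of $S$ supported in $I$. A perfect dyadic Calderón–Zygmund operator is $Tf(x)=\int K(x,y)f(y)\,dy$, where $K$ is a locally integrable function on $[0,2^M]\times[0,2^M]$ with: (a) $|K(x,y)|\lesssim 1/|x-y|$;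 (b) $|K(x,y)-K(x',y)|+|K(y,x)-K(y,x')|=0$ whenever $x,x'\in I$, $y\in J$ for some disjoint dyadic intervals $I,J$; (c) $K$ vanishes on $I\times I$ for all dyadic $I$ with $|I|=2^{-M}$, and on $[0,2^{M-1}]\times[2^{M-1},2^M]$ and $[2^{M-1},2^M]\times[0,2^{M-1}]$. Its adjoint $T^*$, with respect to the bilinear pairing $\langle f,g\rangle=\int fg$ (no complex conjugation), has kernel $K(y,x)$. $A\lesssim B$ means $A\le CB$ with $C$ a constant independent of $M$ (and of $P$, $x$, $y$). *)

(* Defs.v *)
From HB Require Import structures.
From mathcomp Require Import all_boot all_order all_algebra.
From mathcomp Require Import complex.
From mathcomp Require Import all_classical all_reals all_analysis.

Set Implicit Arguments.
Unset Strict Implicit.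
Unset Printing Implicit Defensive.

Import Order.TTheory GRing.Theory Num.Theory.
Import numFieldNormedType.Exports.

Local Open Scope classical_set_scope.
Local Open Scope complex_scope.
Local Open Scope ring_scope.

(* |z| as an element of R (the generic norm `|z| on R[i] is R[i]-valued). *)
Definition cabs (R : realType) (z : R[i]) : R := ComplexField.Normc.normc z.

Definition cmeasurable (R : realType) (D : set R) (f : R -> R[i]) : Prop :=
  measurable_fun D (fun x => complex.Re (f x)) /\
  measurable_fun D (fun x => complex.Im (f x)).

Definition cintegral (R : realType) (D : set R) (f : R -> R[i]) : R[i] :=
  Rintegral lebesgue_measure D (fun x => complex.Re (f x)) +i*
  Rintegral lebesgue_measure D (fun x => complex.Im (f x)).

Definition domain (R : realType) (M : nat) : set R := `[0, 2 ^+ M]%classic.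
Arguments domain : clear implicits.

(* Dyadic pos scale stands for [pos * 2^scale, (pos + 1) * 2^scale[.
   Since null sets are immaterial, the half-open representative is used: two
   dyadic intervals are then disjoint as sets iff they are disjoint up to a
   null set. *)
Record dyadic : Type := Dyadic { pos : int ; scale : int }.

Definition dlen (R : realType) (I : dyadic) : R := (2 : R) ^ scale I.

Definition dset (R : realType) (I : dyadic) : set R :=
  `[(pos I)%:~R * dlen R I, (pos I + 1)%:~R * dlen R I[%classic.
Arguments dset : clear implicits.

Definition is_dyadic (R : realType) (M : nat) (I : dyadic) : Prop :=
  - M%:Z <= scale I <= M%:Z /\ dset R I `<=` domain R M.

Definition dleft (I : dyadic) : dyadic := Dyadic (2 * pos I) (scale I - 1).
Definition dright (I : dyadic) : dyadic := Dyadic (2 * pos I + 1) (scale I - 1).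

Record tile (R : realType) : Type :=
  Tile { tile_int : dyadic ; tile_freq : set R }.

Definition lacunary_tile (R : realType) (I : dyadic) : tile R :=
  Tile I `[(dlen R I)^-1, 2 / dlen R I]%classic.

Definition Pplus (R : realType) (M : nat) : set (tile R) :=
  [set P | exists2 I, is_dyadic R M I & P = lacunary_tile R I].

Definition dchi (R : realType) (I : dyadic) (x : R) : R[i] :=
  (\1_(dset R I) x : R)%:C.

Definition haar (R : realType) (P : tile R) (x : R) : R[i] :=
  ((Num.sqrt (dlen R (tile_int P)))^-1)%:C *
  (dchi (dleft (tile_int P)) x - dchi (dright (tile_int P)) x).

Definition in_span (R : realType) (G : set (R -> R[i])) (f : R -> R[i]) : Prop :=
  exists (n : nat) (c : 'I_n -> R[i]) (g : 'I_n -> R -> R[i]),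
    (forall i, G (g i)) /\ (forall x, f x = \sum_(i < n) c i * g i x).

Definition test_function (R : realType) (M : nat) : (R -> R[i]) -> Prop :=
  in_span ([set haar P | P in @Pplus R M] `|`
           [set @dchi R I | I in [set I | is_dyadic R M I]]).

Definition test_function_on (R : realType) (M : nat) (I : dyadic)
    (f : R -> R[i]) : Prop :=
  test_function M f /\ (forall x, ~ dset R I x -> f x = 0).

Definition avg (R : realType) (I : dyadic) (f : R -> R[i]) : R[i] :=
  ((dlen R I)^-1)%:C * cintegral (dset R I) f.

(* On the compact square, locally integrable means integrable. *)
Definition loc_integrable_kernel (R : realType) (M : nat) (K : R -> R -> R[i]) :
    Prop :=
  let D := domain R M `*` domain R M in
  let mu2 := (@lebesgue_measure R \x @lebesgue_measure R)%E in
  mu2.-integrable D (fun z : R * R => (complex.Re (K z.1 z.2))%:E) /\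
  mu2.-integrable D (fun z : R * R => (complex.Im (K z.1 z.2))%:E).

(* A is the implied constant in |K(x,y)| <~ 1/|x-y|. *)
Definition perfect_dyadic_kernel (R : realType) (M : nat) (A : R)
    (K : R -> R -> R[i]) : Prop :=
  [/\ loc_integrable_kernel M K,
      forall x y, domain R M x -> domain R M y -> x != y ->
        cabs (K x y) <= A / `|x - y|,
      forall I J, is_dyadic R M I -> is_dyadic R M J ->
        dset R I `&` dset R J = set0 ->
        forall x x' y, dset R I x -> dset R I x' -> dset R J y ->
          cabs (K x y - K x' y) + cabs (K y x - K y x') = 0,
      forall I, is_dyadic R M I -> dlen R I = 2 ^ (- M%:Z) ->
        forall x y, dset R I x -> dset R I y -> K x y = 0 &
      forall x y, dset R (Dyadic 0 (M%:Z - 1)) x ->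
        dset R (Dyadic 1 (M%:Z - 1)) y -> K x y = 0 /\ K y x = 0].

Definition kernel_op (R : realType) (M : nat) (K : R -> R -> R[i])
    (f : R -> R[i]) (x : R) : R[i] :=
  cintegral (domain R M) (fun y => K x y * f y).

(* The adjoint for the bilinear pairing: no complex conjugation. *)
Definition adjoint_kernel (R : realType) (K : R -> R -> R[i]) : R -> R -> R[i] :=
  fun x y => K y x.

Definition L2norm (R : realType) (M : nat) (f : R -> R[i]) : \bar R :=
  Lnorm (@lebesgue_measure R) 2%:E
    (fun x => (((fun t => cabs (f t)) \_ (domain R M)) x)%:E).

Definition in_L2 (R : realType) (M : nat) (f : R -> R[i]) : Prop :=
  cmeasurable (domain R M) f /\ (L2norm M f < +oo)%E.

(* Main.v *)
Require Import Defs.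
From mathcomp Require Import all_boot all_order all_algebra.
From mathcomp Require Import complex.
From mathcomp Require Import all_classical all_reals all_analysis.
From mathcomp Require Import measurable_realfun.
From mathcomp Require Import ring lra zify.

(* Condition (b) makes the kernel constant on I x J for dyadic siblings I, J, and
   by (c) it vanishes on the finest diagonal squares: T is a finite matrix acting
   on averages over the finest intervals.

   For each of the two systems b^1, b^2 one stops, below an interval S, at the
   maximal Q where the mean of b_S is small or where b_S or its image has large
   energy; since b_S has mean 1 and bounded energy, these leave a fixed proportion of
   S uncovered, so the stopping intervals form a Carleson family.  Let S1(P), S2(P) be the
   minimal stopping intervals containing P, and let
     f_P = ([f]_P / [b^1_{S1(P)}]_P) b^1_{S1(P)} 1_P,
     g_P = ([g]_P / [b^2_{S2(P)}]_P) b^2_{S2(P)} 1_P.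
   Since f and f_P have the same sum over P and the kernel is constant on products
   of siblings, <Tf, g> telescopes into <T f_top, g_top> plus, for each P, the
   remainder obtained by passing from (f_P, g_P) to the children of P.  If P has a
   stopping child the remainder is bounded by |P| [|f|]_P [|g|]_P, thanks to
   <T(b^1_{S1(P)} 1_P), b^2_{S2(P)} 1_P> = O(|P|): the difference
   b^1_{S1(P)} 1_P - [b^1_{S1(P)}]_P b^1_P has mean zero, so that its image stays
   in P and T may be moved to b^2_{S2(P)}.  Otherwise the remainder is quadratic in
   the Haar coefficients at P of f, g, b^1, b^2, b^1 T^*b^2 and b^2 T b^1.  The
   means of the last four are bounded between stopping times, so that their Haar
   coefficients satisfy a Carleson condition, and the Carleson embedding theorem
   gives |<Tf, g>| <= C (|f|_2^2 + |g|_2^2). *)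

Set Implicit Arguments.
Unset Strict Implicit.
Unset Printing Implicit Defensive.

Import Order.TTheory GRing.Theory Num.Theory.

Local Open Scope classical_set_scope.
Local Open Scope complex_scope.
Local Open Scope ring_scope.

(** * The modulus of a complex number *)

Section ComplexModulus.
Variable R : realType.
Implicit Types z w : R[i].

Lemma cabs_ge0 z : 0 <= cabs z.
Proof. by case: z => a b; exact: sqrtr_ge0. Qed.

Lemma cabs0 : cabs (0 : R[i]) = 0.
Proof. exact: ComplexField.Normc.normc0. Qed.

Lemma cabs1 : cabs (1 : R[i]) = 1.
Proof. exact: ComplexField.Normc.normc1. Qed.

Lemma cabsM z w : cabs (z * w) = cabs z * cabs w.
Proof. exact: ComplexField.Normc.normcM. Qed.

Lemma cabsV z : cabs z^-1 = (cabs z)^-1.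
Proof. exact: ComplexField.Normc.normcV. Qed.

Lemma cabs_sqr z : cabs z ^+ 2 = complex.Re z ^+ 2 + complex.Im z ^+ 2.
Proof. by case: z => a b; rewrite /cabs /= sqr_sqrtr// addr_ge0 ?sqr_ge0. Qed.

Lemma cabsN z : cabs (- z) = cabs z.
Proof. by case: z => a b; rewrite /cabs /= !sqrrN. Qed.

Lemma cabsD z w : cabs (z + w) <= cabs z + cabs w.
Proof. exact: le_normcD. Qed.

Lemma cabsB z w : cabs (z - w) <= cabs z + cabs w.
Proof. by rewrite (le_trans (cabsD _ _))// cabsN. Qed.

Lemma cabs_real (x : R) : cabs x%:C = `|x|.
Proof. by rewrite /cabs /= expr0n addr0 sqrtr_sqr. Qed.

Lemma cabs_exp2 m : cabs (2 ^+ m : R[i]) = 2 ^+ m.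
Proof.
rewrite (_ : 2 ^+ m = (2 ^+ m : R)%:C); first by rewrite cabs_real ger0_norm.
by rewrite rmorphXn/= rmorphMn/=.
Qed.

Lemma cabs_eq0 z : cabs z = 0 -> z = 0.
Proof. exact: ComplexField.Normc.eq0_normc. Qed.

Lemma cabs_add_eq0 z w : cabs z + cabs w = 0 -> z = 0 /\ w = 0.
Proof.
move=> zw; have := cabs_ge0 z; have := cabs_ge0 w.
by split; apply: cabs_eq0; lra.
Qed.

Lemma parallelogram z w :
  cabs (z + w) ^+ 2 + cabs (z - w) ^+ 2 = 2 * (cabs z ^+ 2 + cabs w ^+ 2).
Proof. by rewrite !cabs_sqr; case: z => a b; case: w => c d /=; ring. Qed.

Lemma cabs_conj z : cabs (conjc z) = cabs z.
Proof. by case: z => a b; rewrite /cabs /= sqrrN. Qed.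

Lemma mul_conjc z : z * conjc z = (cabs z ^+ 2)%:C.
Proof.
rewrite cabs_sqr; case: z => a b; apply/eqP; rewrite eq_complex /=.
by apply/andP; split; apply/eqP; ring.
Qed.

End ComplexModulus.

(** * Sums over the dyadic tree *)

Section DyadicSums.

(* A node of the dyadic tree is the path leading to it from the root, last step
   first: the children of s are false :: s and true :: s, and the descendants
   of s are the sequences having s as a suffix. *)
Fixpoint dsum (V : nmodType) (m : nat) (s : seq bool) (f : seq bool -> V) : V :=
  if m is m'.+1 then dsum m' (false :: s) f + dsum m' (true :: s) f else f s.

Lemma eq_dsum (V : nmodType) m s (f g : seq bool -> V) :
  (forall t, size t = (m + size s)%N -> suffix s t -> f t = g t) ->
  dsum m s f = dsum m s g.
Proof.
elim: m s => [|m IH] s fg /=; first by apply: fg; rewrite ?suffix_refl.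
have E b : dsum m (b :: s) f = dsum m (b :: s) g.
  apply: IH => t st sst; apply: fg; first by rewrite st /= addnS.
  by apply: suffix_trans sst; apply: suffix_cons.
by rewrite !E.
Qed.

Lemma dsum0 (V : nmodType) m s (f : seq bool -> V) :
  (forall t, size t = (m + size s)%N -> suffix s t -> f t = 0) ->
  dsum m s f = 0.
Proof.
move=> f0; rewrite (@eq_dsum V m s f (fun=> 0))//.
by elim: m s {f0} => [|m IH] s //=; rewrite !IH addr0.
Qed.

Lemma dsumD (V : nmodType) m s (f g : seq bool -> V) :
  dsum m s (fun t => f t + g t) = dsum m s f + dsum m s g.
Proof. by elim: m s => [|m IH] s //=; rewrite !IH addrACA. Qed.

Lemma dsumN (V : zmodType) m s (f : seq bool -> V) :
  dsum m s (fun t => - f t) = - dsum m s f.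
Proof. by elim: m s => [|m IH] s //=; rewrite !IH opprD. Qed.

Lemma dsumB (V : zmodType) m s (f g : seq bool -> V) :
  dsum m s (fun t => f t - g t) = dsum m s f - dsum m s g.
Proof. by rewrite dsumD dsumN. Qed.

Lemma dsumZ (V : pzRingType) m s (a : V) f :
  dsum m s (fun t => a * f t) = a * dsum m s f.
Proof. by elim: m s => [|m IH] s //=; rewrite !IH mulrDr. Qed.

Lemma dsum_const (V : pzRingType) m s (a : V) :
  dsum m s (fun=> a) = 2 ^+ m * a.
Proof.
elim: m s => [|m IH] s /=; first by rewrite expr0 mul1r.
by rewrite !IH exprS -mulrA [RHS]mulr_natl mulr2n.
Qed.

Lemma dsum_exchange (V : nmodType) m s p t (f : seq bool -> seq bool -> V) :
  dsum m s (fun i => dsum p t (f i)) = dsum p t (fun j => dsum m s (f^~ j)).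
Proof. by elim: m s => [|m IH] s //=; rewrite !IH -dsumD. Qed.

(** Induction on [u] from the step nearest to [s]: of the two children of [s], only the one on the
    way to [u ++ s] has descendants with that suffix, so the other half of the sum vanishes. *)
Lemma dsum_sub (V : nmodType) m s u (f : seq bool -> V) :
  dsum (size u + m) s (fun i => if suffix (u ++ s) i then f i else 0) =
  dsum m (u ++ s) f.
Proof.
elim/last_ind: u s => [|u b IH] s /=.
  by apply: eq_dsum => t _ ->.
rewrite size_rcons cat_rcons addSn /=.
have E c : c != b ->
    dsum (size u + m) (c :: s)
      (fun i => if suffix (u ++ b :: s) i then f i else 0) = 0.
  move=> cb; apply: dsum0 => t st /suffixP [v tE]; case: ifP => // /suffixP [w].
  (* Reversing the paths turns suffixes into prefixes, which already differ at the step following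
     [s]. *)
  move/(congr1 rev); rewrite tE catA !rev_cat !rev_cons !cat_rcons.
  by move/eqP; rewrite eqseq_cat// => /andP [_ /eqP []] cE; rewrite cE eqxx in cb.
by case: b E => E; rewrite -[in RHS]IH; [rewrite (E false)// add0r|rewrite (E true)// addr0].
Qed.

Section Real.
Variable R : realType.
Implicit Types (f g : seq bool -> R) (u v : seq bool -> R[i]).

Lemma ler_dsum m s f g :
  (forall t, size t = (m + size s)%N -> suffix s t -> f t <= g t) ->
  dsum m s f <= dsum m s g.
Proof.
elim: m s => [|m IH] s fg /=; first by apply: fg; rewrite ?suffix_refl.
have E b : dsum m (b :: s) f <= dsum m (b :: s) g.
  apply: IH => t st sst; apply: fg; first by rewrite st /= addnS.
  by apply: suffix_trans sst; apply: suffix_cons.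
by rewrite lerD.
Qed.

Lemma dsum_ge0 m s f : (forall t, 0 <= f t) -> 0 <= dsum m s f.
Proof. by move=> f0; elim: m s => [|m IH] s //=; rewrite addr_ge0. Qed.

Lemma cabs_dsum m s u : cabs (dsum m s u) <= dsum m s (fun t => cabs (u t)).
Proof.
by elim: m s => [|m IH] s //=; rewrite (le_trans (cabsD _ _))// lerD.
Qed.

Lemma cabs_dsumM m s u v :
  cabs (dsum m s (fun t => u t * v t)) <=
  (dsum m s (fun t => cabs (u t) ^+ 2) + dsum m s (fun t => cabs (v t) ^+ 2)) / 2.
Proof.
rewrite (le_trans (cabs_dsum _ _ _))// -dsumD mulrC -dsumZ; apply: ler_dsum => t _ _ /=.
by rewrite cabsM; have := sqr_ge0 (cabs (u t) - cabs (v t)); nra.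
Qed.

Lemma sqr_dsum_le m s f : (dsum m s f) ^+ 2 <= 2 ^+ m * dsum m s (fun t => f t ^+ 2).
Proof.
elim: m s => [|m IH] s /=; first by rewrite mul1r.
have := IH (false :: s); have := IH (true :: s).
rewrite [2 ^+ m.+1]exprS -mulrA mulrDr; set x := dsum _ _ f; set y := dsum _ _ f.
set p := 2 ^+ m * _; set q := 2 ^+ m * _ => hp hq.
by have := sqr_ge0 (x - y); nra.
Qed.

End Real.
End DyadicSums.

(** * Carleson sequences *)

Section Carleson.
Variable R : realType.
Implicit Types (g h : nat -> seq bool -> R) (u : seq bool -> R[i]).

(* Sum of g p t over the proper ancestors t, below s, of the leaves at depth m
   below s; p is the height of t above the leaves, so that t carries the
   interval length 2 ^ p. *)
Fixpoint nsum (m : nat) (s : seq bool) g : R :=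
  if m is m'.+1 then
    g m s + (nsum m' (false :: s) g + nsum m' (true :: s) g)
  else 0.

(** The Haar coefficient without its normalisation: against the unit Haar vector on [2 ^+ p] leaves
    the squared coefficient is [cabs (hdiff p s u) ^+ 2 / 2 ^+ p]. A leaf carries no Haar vector,
    whence the value 0. *)
Definition hdiff (p : nat) (s : seq bool) u : R[i] :=
  if p is p'.+1 then dsum p' (false :: s) u - dsum p' (true :: s) u else 0.

Lemma ler_nsum m s g h :
  (forall p t, (p + size t = m + size s)%N -> g p t <= h p t) ->
  nsum m s g <= nsum m s h.
Proof.
elim: m s => [|m IH] s gh //=.
by rewrite !lerD ?gh ?IH// => p t pt; apply: gh; rewrite pt /= addnS.
Qed.

Lemma nsumD m s g h :
  nsum m s (fun p t => g p t + h p t) = nsum m s g + nsum m s h.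
Proof. by elim: m s => [|m IH] s /=; rewrite ?addr0// !IH; lra. Qed.

Lemma nsumZ m s a g : nsum m s (fun p t => a * g p t) = a * nsum m s g.
Proof. by elim: m s => [|m IH] s /=; rewrite ?mulr0// !IH; lra. Qed.

Lemma nsum_ge0 m s g : (forall p t, 0 <= g p t) -> 0 <= nsum m s g.
Proof. by move=> g0; elim: m s => [|m IH] s //=; rewrite !addr_ge0. Qed.

Lemma sqr_div_convex (x y v w : R) : 0 < v -> 0 < w ->
  (x + y) ^+ 2 / (v + w) <= x ^+ 2 / v + y ^+ 2 / w.
Proof.
move=> v0 w0; have vw0 : 0 < v + w by rewrite addr_gt0.
rewrite -subr_ge0.
rewrite (_ : _ - _ = (x * w - y * v) ^+ 2 / (v * w * (v + w))); last first.
  by field; rewrite !gt_eqF.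
by rewrite divr_ge0 ?sqr_ge0// !mulr_ge0// ltW.
Qed.

(* The Bellman function of the embedding is X - Y ^ 2 / z, convexity of
   Y ^ 2 / z giving the concavity and its decrease in z the gain. *)
Lemma carleson_embedding (n : nat) (Lam : R) (al : nat -> seq bool -> R)
    (f : seq bool -> R) :
  0 < Lam -> (forall p t, 0 <= al p t) ->
  (forall m s, (m + size s = n)%N -> nsum m s al <= Lam * 2 ^+ m) ->
  forall m s, (m + size s = n)%N ->
  nsum m s (fun p t => al p t * (dsum p t f / 2 ^+ p) ^+ 2) <=
  4 * Lam * dsum m s (fun t => f t ^+ 2).
Proof.
move=> Lam0 al0 alLam.
(* By the packing hypothesis [z] lies between Lam 2^m and 2 Lam 2^m; the upper bound makes the drop
   of Y^2 / z pay for the term at the node. At a leaf [z] equals [Lam], and the Bellman bound reads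
   0 <= 0. *)
pose z m s := Lam * 2 ^+ m + nsum m s al.
have l0 m : 0 < 2 ^+ m :> R by rewrite exprn_gt0.
have z0 m s : 0 < z m s by rewrite ltr_pwDl ?nsum_ge0// mulr_gt0.
suff H m s : (m + size s = n)%N ->
    nsum m s (fun p t => al p t * (dsum p t f / 2 ^+ p) ^+ 2) <=
    4 * Lam * dsum m s (fun t => f t ^+ 2)
    - 4 * Lam ^+ 2 * ((dsum m s f) ^+ 2 / z m s).
  move=> m s ms; apply: (le_trans (H _ _ ms)); rewrite gerBl.
  apply: mulr_ge0; first by rewrite mulr_ge0 ?sqr_ge0.
  by apply: divr_ge0; rewrite ?sqr_ge0// ltW.
elim: m s => [|m IH] s ms.
  rewrite /= /z /= expr0 mulr1 addr0.
  rewrite le_eqVlt; apply/orP; left; apply/eqP; field.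
  by rewrite gt_eqF.
have ms' b : (m + size (b :: s) = n)%N by rewrite /= addnS.
have h0 := IH _ (ms' false); have h1 := IH _ (ms' true).
have zE : z m.+1 s = z m (false :: s) + z m (true :: s) + al m.+1 s.
  by rewrite /z /= exprS; lra.
have zle : z m.+1 s <= 4 * Lam * 2 ^+ m.
  by have := alLam _ _ ms; rewrite /z exprS; lra.
have c := sqr_div_convex (dsum m (false :: s) f) (dsum m (true :: s) f)
  (z0 m (false :: s)) (z0 m (true :: s)).
set Y := dsum m (false :: s) f + dsum m (true :: s) f in c.
set w := z m (false :: s) + z m (true :: s) in c zE.
have w0 : 0 < w by rewrite addr_gt0.
have zp := z0 m.+1 s.
have gain : al m.+1 s * (Y / 2 ^+ m.+1) ^+ 2 <=
    4 * Lam ^+ 2 * (Y ^+ 2 / w) - 4 * Lam ^+ 2 * (Y ^+ 2 / z m.+1 s).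
  have -> : 4 * Lam ^+ 2 * (Y ^+ 2 / w) - 4 * Lam ^+ 2 * (Y ^+ 2 / z m.+1 s) =
      al m.+1 s * (Y ^+ 2 * (4 * Lam ^+ 2 / (w * z m.+1 s))).
    rewrite zE; field; rewrite -zE.
    by rewrite !gt_eqF.
  rewrite ler_wpM2l// expr_div_n ler_wpM2l ?sqr_ge0//.
  rewrite ler_pdivlMr ?mulr_gt0// mulrC ler_pdivrMr ?exprn_gt0//.
  have wz : w <= z m.+1 s by rewrite zE lerDl.
  have : w * z m.+1 s <= (4 * Lam * 2 ^+ m) * (4 * Lam * 2 ^+ m).
    by rewrite ler_pM ?(ltW w0) ?(ltW zp)// (le_trans wz).
  by rewrite [2 ^+ m.+1]exprS; set l := 2 ^+ m; lra.
have L2 : 0 <= 4 * Lam ^+ 2 by rewrite mulr_ge0 ?sqr_ge0.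
have := ler_wpM2l L2 c.
rewrite /= -/Y.
lra.
Qed.

(** One level of Parseval: the parallelogram law exchanges the energy of the two child means for
    that of the parent mean and of the Haar coefficient. *)
Lemma sqr_children (x y : R[i]) m :
  cabs x ^+ 2 / 2 ^+ m + cabs y ^+ 2 / 2 ^+ m =
  cabs (x + y) ^+ 2 / 2 ^+ m.+1 + cabs (x - y) ^+ 2 / 2 ^+ m.+1.
Proof.
rewrite -!mulrDl parallelogram [2 ^+ m.+1]exprS; field.
by rewrite expf_neq0// pnatr_eq0.
Qed.

Lemma haar_parseval m s u :
  cabs (dsum m s u) ^+ 2 / 2 ^+ m +
    nsum m s (fun p t => cabs (hdiff p t u) ^+ 2 / 2 ^+ p) =
  dsum m s (fun t => cabs (u t) ^+ 2).
Proof.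
elim: m s => [|m IH] s /=; first by rewrite expr0 divr1 addr0.
by rewrite -!IH addrA -sqr_children; lra.
Qed.

(* Between stopping nodes the potential |sum of W s over s| ^ 2 / 2 ^ m
   telescopes; a stopping node costs at most the bound on the potential. *)
Lemma square_function (n : nat) (W : seq bool -> seq bool -> R[i])
    (stop : pred (seq bool)) (L Lam : R) :
  0 <= L ->
  (forall b s, ~~ stop s -> W (b :: s) = W s) ->
  (forall m s, (m + size s = n)%N -> cabs (dsum m s (W s)) <= L * 2 ^+ m) ->
  (forall m s, (m + size s = n)%N ->
     nsum m s (fun p t => if stop t then 2 ^+ p else 0) <= Lam * 2 ^+ m) ->
  forall m s, (m + size s = n)%N ->
  nsum m s (fun p t => if stop t then 0
                       else cabs (hdiff p t (W t)) ^+ 2 / 2 ^+ p) <=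
  L ^+ 2 * (1 + Lam) * 2 ^+ m.
Proof.
move=> L0 Wc WL Wst.
have l0 m : 0 < 2 ^+ m :> R by rewrite exprn_gt0.
have phi m s : (m + size s = n)%N ->
    cabs (dsum m s (W s)) ^+ 2 / 2 ^+ m <= L ^+ 2 * 2 ^+ m.
  move=> ms; rewrite ler_pdivrMr// -mulrA -expr2 -exprMn.
  by rewrite lerXn2r ?nnegrE ?cabs_ge0 ?WL// mulr_ge0// ltW.
suff H m s : (m + size s = n)%N ->
    cabs (dsum m s (W s)) ^+ 2 / 2 ^+ m +
    nsum m s (fun p t => if stop t then 0
                         else cabs (hdiff p t (W t)) ^+ 2 / 2 ^+ p) <=
    L ^+ 2 * (2 ^+ m + nsum m s (fun p t => if stop t then 2 ^+ p else 0)).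
  move=> m s ms; have := H m s ms; have := ler_wpM2l (sqr_ge0 L) (Wst m s ms).
  have : 0 <= cabs (dsum m s (W s)) ^+ 2 / 2 ^+ m.
    by rewrite divr_ge0 ?sqr_ge0 ?ltW.
  lra.
elim: m s => [|m IH] s ms; first by rewrite /= !addr0; exact: (phi 0%N).
have ms' b : (m + size (b :: s) = n)%N by rewrite /= addnS.
have h0 := IH _ (ms' false); have h1 := IH _ (ms' true).
have p0 b : 0 <= cabs (dsum m (b :: s) (W (b :: s))) ^+ 2 / 2 ^+ m.
  by rewrite divr_ge0 ?sqr_ge0 ?ltW.
have := p0 true; have := p0 false; have := phi _ _ ms.
rewrite /=; case: ifPn => st.
  by rewrite [2 ^+ m.+1]exprS; lra.
move: h0 h1; rewrite !Wc//.
have := sqr_children (dsum m (false :: s) (W s)) (dsum m (true :: s) (W s)) m.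
rewrite [2 ^+ m.+1]exprS.
lra.
Qed.

End Carleson.

(** * Stopping intervals *)

Section StoppingTime.
Variables (R : realType) (n : nat) (L : R) (b h : seq bool -> seq bool -> R[i]).

(* h a is meant to be the image of b a under the operator. *)
Definition energy (a : seq bool) (m : nat) (s : seq bool) : R :=
  dsum m s (fun t => cabs (b a t) ^+ 2 + cabs (h a t) ^+ 2).

Definition good (a s : seq bool) : bool :=
  let m := (n - size s)%N in
  (2 ^+ m / 4 <= cabs (dsum m s (b a))) && (energy a m s <= L * 2 ^+ m).

(** The minimal stopping interval containing [s], that is S1(P) or S2(P) of the overview; the root
    is always a stopping interval. *)
Fixpoint anchor (s : seq bool) : seq bool :=
  if s is _ :: s' then if good (anchor s') s then anchor s' else s else [::].

(** The nodes with a stopping child, where the remainder is estimated without cancellation. *)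
Definition changes (s : seq bool) : bool :=
  (anchor (false :: s) != anchor s) || (anchor (true :: s) != anchor s).

Lemma energy_split a m s :
  energy a m.+1 s = energy a m (false :: s) + energy a m (true :: s).
Proof. by []. Qed.

Lemma changesF s c : ~~ changes s -> anchor (c :: s) = anchor s.
Proof. by rewrite negb_or !negbK => /andP[/eqP ? /eqP ?]; case: c. Qed.

Lemma anchor_stop c s : anchor (c :: s) != anchor s ->
  anchor (c :: s) = c :: s /\ ~~ good (anchor s) (c :: s).
Proof. by rewrite /=; case: ifPn => //; rewrite eqxx. Qed.

Variable B : R.
Hypothesis B1 : 1 <= B.
Hypothesis LE : L = 4 * B ^+ 2.
Hypothesis b_sum : forall m s, (m + size s = n)%N -> dsum m s (b s) = 2 ^+ m.
Hypothesis b_energy : forall m s, (m + size s = n)%N -> energy s m s <= B * 2 ^+ m.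

Lemma goodE a m s : (m + size s = n)%N ->
  good a s =
  (2 ^+ m / 4 <= cabs (dsum m s (b a))) && (energy a m s <= L * 2 ^+ m).
Proof. by move=> ms; rewrite /good -ms addnK. Qed.

(** A node that starts a new anchor is good for itself: the mean is 1 and the energy constant [B] is
    at most [L]. *)
Lemma good_anchor m s : (m + size s = n)%N -> good (anchor s) s.
Proof.
have gs : forall m s, (m + size s = n)%N -> good s s.
  move=> {}m {}s ms; have l0 : 0 < 2 ^+ m :> R by rewrite exprn_gt0.
  rewrite (goodE _ ms) b_sum// cabs_exp2; apply/andP; split; first by lra.
  by rewrite (le_trans (b_energy ms))// ler_wpM2r ?ltW// LE; have := B1; nra.
case: s => [|x s] ms /=; first exact: gs ms.
by case: ifP => // _; apply: gs ms.
Qed.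

Let B0 : 0 < B. Proof. exact: lt_le_trans B1. Qed.

Lemma energy_ge0 a m s : 0 <= energy a m s.
Proof. by apply: dsum_ge0 => t; rewrite addr_ge0 ?sqr_ge0. Qed.

(** Pointwise this is x <= x^2 / (4B) + B, i.e. (x - 2B)^2 >= 0. *)
Lemma sum_le_energy a m s :
  cabs (dsum m s (b a)) <= energy a m s / (4 * B) + B * 2 ^+ m.
Proof.
rewrite (le_trans (cabs_dsum _ _ _))// [B * _]mulrC -(dsum_const m s B).
rewrite [_ / _]mulrC -dsumZ -dsumD; apply: ler_dsum => t _ _.
rewrite mulrC -subr_ge0; set x := cabs _; set y := cabs _.
rewrite (_ : _ - _ = ((x - 2 * B) ^+ 2 + y ^+ 2) / (4 * B)); last first.
  by field; rewrite gt_eqF.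
by rewrite divr_ge0 ?addr_ge0 ?sqr_ge0// mulr_ge0// ltW.
Qed.

(* A stopping interval on which the mean of b is small contributes to the first
   term, one on which the energy is large to the second. *)
Lemma sum_le_core m s Q : (m + size s = n)%N -> anchor s = Q ->
  cabs (dsum m s (b Q)) <= 2 ^+ m / 4 + energy Q m s / (2 * B) +
    B * dsum m s (fun t => (anchor t == Q)%:R).
Proof.
have half e : e / (2 * B) = e / (4 * B) + e / (4 * B).
  by field; rewrite gt_eqF.
elim: m s => [|m IH] s ms sQ.
  have := sum_le_energy Q 0 s; have := energy_ge0 Q 0 s.
  have -> : dsum 0 s (fun t => (anchor t == Q)%:R) = 1 :> R by rewrite /= sQ eqxx.
  rewrite expr0 half => e0 e1.
  have : 0 <= energy Q 0 s / (4 * B) by rewrite divr_ge0// mulr_ge0// ltW.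
  lra.
have E c : cabs (dsum m (c :: s) (b Q)) <=
    2 ^+ m / 4 + energy Q m (c :: s) / (2 * B) +
    B * dsum m (c :: s) (fun t => (anchor t == Q)%:R).
  have ms' : (m + size (c :: s) = n)%N by rewrite /= addnS.
  have [cQ|cQ] := eqVneq (anchor (c :: s)) Q; first exact: IH.
  have l0 : 0 <= 2 ^+ m :> R by rewrite exprn_ge0.
  have D0 : 0 <= B * dsum m (c :: s) (fun t => (anchor t == Q)%:R).
    by rewrite mulr_ge0 ?(ltW B0)// dsum_ge0.
  have E0 : 0 <= energy Q m (c :: s) / (4 * B).
    by rewrite divr_ge0 ?energy_ge0// mulr_ge0// ltW.
  have := cQ; rewrite -{1}sQ => /anchor_stop[_]; rewrite sQ (goodE _ ms').
  rewrite negb_and -!ltNge half => /orP[|big]; first by lra.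
  have := sum_le_energy Q m (c :: s).
  (* The energy here exceeds 4 B^2 2^m, so the summand B 2^m of [sum_le_energy] is itself at most a
     quarter of the energy over B; the two quarters make the half in the claim. *)
  suff : B * 2 ^+ m <= energy Q m (c :: s) / (4 * B) by lra.
  by rewrite ler_pdivlMr ?mulr_gt0//; move: big; rewrite LE; lra.
have := E false; have := E true; rewrite /= energy_split exprS !mulrDl.
have := cabsD (dsum m (false :: s) (b Q)) (dsum m (true :: s) (b Q)).
lra.
Qed.

(** In [sum_le_core] the small means use up 1/4 of the total mean 1 and the large energies 1/2. The
    remaining quarter must come from the leaves still anchored at [s]. *)
Lemma core_large m s : (m + size s = n)%N -> anchor s = s ->
  2 ^+ m <= 4 * B * dsum m s (fun t => (anchor t == s)%:R).
Proof.
move=> ms sa; have := sum_le_core ms sa.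
rewrite b_sum// cabs_exp2.
suff : energy s m s / (2 * B) <= 2 ^+ m / 2 by lra.
by rewrite ler_pdivrMr ?mulr_gt0//; have := b_energy ms; lra.
Qed.

(** A stopping child [c :: s] is paid for by the leaves anchored exactly there, a fixed proportion
    of it by [core_large]. They count for [s] but not for [c :: s], so each leaf pays only through
    its own anchor. The factor 8 is the 4 of [core_large] doubled by passing from the child to the
    parent. *)
Lemma stopping_packing_core m s : (m + size s = n)%N ->
  nsum m s (fun p t => if changes t then 2 ^+ p else 0) <=
  8 * B * dsum m s (fun t => (size s < size (anchor t))%N%:R).
Proof.
elim: m s => [|m IH] s ms; first by rewrite /= !mulr_ge0// ltW.
have E c : nsum m (c :: s) (fun p t => if changes t then 2 ^+ p else 0) +
    (if anchor (c :: s) != anchor s then 2 ^+ m.+1 else 0) <=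
    8 * B * dsum m (c :: s) (fun t => (size s < size (anchor t))%N%:R).
  have ms' : (m + size (c :: s) = n)%N by rewrite /= addnS.
  have BB : 0 <= 8 * B by rewrite mulr_ge0// ltW.
  case: ifPn => [/anchor_stop[ac _]|_]; last first.
    rewrite addr0 (le_trans (IH _ ms'))// ler_wpM2l//.
    by apply: ler_dsum => t _ _; rewrite ler_nat /=; lia.
  suff : dsum m (c :: s) (fun t => (size (c :: s) < size (anchor t))%N%:R) +
      dsum m (c :: s) (fun t => (anchor t == c :: s)%:R) <=
      dsum m (c :: s) (fun t => (size s < size (anchor t))%N%:R) :> R.
    move=> /(ler_wpM2l BB); have := IH _ ms'; have := core_large ms' ac.
    by rewrite exprS; lra.
  rewrite -dsumD; apply: ler_dsum => t _ _.
  have [->|_] := eqVneq (anchor t) (c :: s); first by rewrite /= ltnn ltnSn add0r.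
  by rewrite addr0 ler_nat /=; lia.
have := E false; have := E true; rewrite /= mulrDr /changes.
have l0 : 0 <= 2 ^+ m.+1 :> R by rewrite exprn_ge0.
by do 2![case: ifP => _]; rewrite ?orbT ?orbF //=; lra.
Qed.

Lemma stopping_packing m s : (m + size s = n)%N ->
  nsum m s (fun p t => if changes t then 2 ^+ p else 0) <= 8 * B * 2 ^+ m.
Proof.
move=> ms; rewrite (le_trans (stopping_packing_core ms))//.
rewrite ler_wpM2l ?mulr_ge0 ?(ltW B0)// -[2 ^+ m]mulr1 -(dsum_const m s 1).
by apply: ler_dsum => t _ _; rewrite lern1 leq_b1.
Qed.

End StoppingTime.

(** * The telescoping remainder *)

Section Remainder.
Variable R : realType.
Implicit Types (x y z w : R[i]) (l L : R).

Lemma cabs_gt0_neq0 z l : 0 < l -> l <= cabs z -> z != 0.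
Proof. by move=> l0 lz; apply: contraTneq lz => ->; rewrite cabs0 -ltNge. Qed.

Lemma cabs_mul_le z w l L : cabs z <= l -> cabs w <= L -> cabs (z * w) <= l * L.
Proof. by move=> zl wL; rewrite cabsM ler_pM ?cabs_ge0. Qed.

Lemma cabs_div_le z w l L : 0 < L -> cabs z <= l -> L <= cabs w ->
  cabs (z / w) <= l / L.
Proof.
move=> L0 zl Lw; rewrite cabsM cabsV ler_pM ?cabs_ge0 ?invr_ge0 ?cabs_ge0//.
by rewrite lef_pV2 ?posrE// (lt_le_trans L0).
Qed.

(** The expression bounded is the numerator of the difference between the ratio f / b on a child and
    on the parent; it is written so as to involve only the Haar differences of f and b and their
    sums. *)
Lemma cross_diff_le (f0 f1 b0 b1 : R[i]) (l L F : R) :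
  1 <= L -> cabs (b0 + b1) <= L * l -> cabs (f0 + f1) <= F * l ->
  cabs ((f0 - f1) * (b0 + b1) - (f0 + f1) * (b0 - b1)) <=
  L * l * (cabs (f0 - f1) + F * cabs (b0 - b1)).
Proof.
move=> L1 bL fF; have F0 : 0 <= F * l * cabs (b0 - b1).
  by rewrite mulr_ge0 ?cabs_ge0// (le_trans (cabs_ge0 _) fF).
rewrite (le_trans (cabsB _ _))// [_ * (cabs _ + _)]mulrDr lerD//.
  by rewrite cabsM mulrC ler_wpM2r ?cabs_ge0.
rewrite cabsM (le_trans (ler_wpM2r (cabs_ge0 _) fF))//.
by have := ler_wpM2r F0 L1; lra.
Qed.

Lemma mean_ratio_diff (f0 f1 b0 b1 : R[i]) (l L F : R) :
  0 < l -> 1 <= L -> l / 8 <= cabs b0 -> l / 4 <= cabs (b0 + b1) ->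
  cabs (b0 + b1) <= L * l -> cabs (f0 + f1) <= F * l ->
  cabs (f0 / b0 - (f0 + f1) / (b0 + b1)) <=
  16 * L * (cabs (f0 - f1) + F * cabs (b0 - b1)) / l.
Proof.
move=> l0 L1 b0l bl bL fF.
have b0N : b0 != 0 by apply: cabs_gt0_neq0 b0l; lra.
have bN : b0 + b1 != 0 by apply: cabs_gt0_neq0 bl; lra.
have -> : f0 / b0 - (f0 + f1) / (b0 + b1) =
    ((f0 - f1) * (b0 + b1) - (f0 + f1) * (b0 - b1)) / (2 * b0 * (b0 + b1)).
  by field; rewrite bN b0N.
have n1 := cross_diff_le L1 bL fF.
have n2 : l ^+ 2 / 16 <= cabs (2 * b0 * (b0 + b1)).
  have c2 : cabs (2 : R[i]) = 2 by rewrite -[2]expr1 cabs_exp2.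
  rewrite !cabsM c2.
  have : l / 8 * (l / 4) <= cabs b0 * cabs (b0 + b1) by rewrite ler_pM//; lra.
  by lra.
apply: le_trans (cabs_div_le _ n1 n2) _; first by rewrite divr_gt0 ?exprn_gt0.
by rewrite le_eqVlt; apply/orP; left; apply/eqP; field; rewrite gt_eqF.
Qed.

(* The weighted sum of the differences of f / b against w only sees the Haar
   coefficients of w and b. *)
Lemma mean_ratio_pairing (f0 f1 b0 b1 w0 w1 : R[i]) (l L F : R) :
  0 < l -> 1 <= L -> l / 8 <= cabs b0 -> l / 8 <= cabs b1 ->
  l / 4 <= cabs (b0 + b1) ->
  cabs (b0 + b1) <= L * l -> cabs (w0 + w1) <= L * l -> cabs (f0 + f1) <= F * l ->
  let c := (f0 + f1) / (b0 + b1) in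
  cabs ((f0 / b0 - c) * w0 + (f1 / b1 - c) * w1) <=
  64 * L ^+ 2 * (cabs (f0 - f1) + F * cabs (b0 - b1)) *
    (cabs (w0 - w1) + cabs (b0 - b1)) / l.
Proof.
move=> l0 L1 b0l b1l bl bL wL fF /=.
have b0N : b0 != 0 by apply: cabs_gt0_neq0 b0l; lra.
have b1N : b1 != 0 by apply: cabs_gt0_neq0 b1l; lra.
have bN : b0 + b1 != 0 by apply: cabs_gt0_neq0 bl; lra.
have -> : (f0 / b0 - (f0 + f1) / (b0 + b1)) * w0 +
    (f1 / b1 - (f0 + f1) / (b0 + b1)) * w1 =
    (((f0 - f1) * (b0 + b1) - (f0 + f1) * (b0 - b1)) *
     ((w0 - w1) * (b0 + b1) - (w0 + w1) * (b0 - b1))) /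
    (4 * (b0 + b1) * b0 * b1).
  by field; rewrite bN b0N b1N.
have n1 := cross_diff_le L1 bL fF.
have n3 : cabs ((w0 - w1) * (b0 + b1) - (w0 + w1) * (b0 - b1)) <=
    L * l * (cabs (w0 - w1) + cabs (b0 - b1)).
  rewrite (le_trans (cabsB _ _))// [_ * (cabs _ + _)]mulrDr lerD//.
    by rewrite cabsM mulrC ler_wpM2r ?cabs_ge0.
  by rewrite cabsM ler_wpM2r ?cabs_ge0.
have n2 : l ^+ 3 / 64 <= cabs (4 * (b0 + b1) * b0 * b1).
  have c4 : cabs (4 : R[i]) = 4.
    by rewrite (_ : 4 = 2 ^+ 2) ?cabs_exp2 //; ring.
  rewrite !cabsM c4.
  have : l / 4 * (l / 8) * (l / 8) <= cabs (b0 + b1) * cabs b0 * cabs b1.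
    by rewrite !ler_pM ?mulr_ge0//; lra.
  by lra.
apply: le_trans (cabs_div_le _ (cabs_mul_le n1 n3) n2) _.
  by rewrite divr_gt0 ?exprn_gt0.
by rewrite le_eqVlt; apply/orP; left; apply/eqP; field; rewrite gt_eqF.
Qed.

(* First index: the child on which the image is tested; second: the child
   carrying the input. *)
Lemma remainder_identity (b0 b1 b0' b1' w0 w1 w0' w1' c c0 c1 d d0 d1
    B00 B01 B10 B11 k k' : R[i]) :
  B00 + B10 = w0 - k * b0 -> B01 + B11 = w1 - k * b1 ->
  B00 + B01 = w0' - k' * b0' -> B10 + B11 = w1' - k' * b1' ->
  (c0 - c) * b0 + (c1 - c) * b1 = 0 -> (d0 - d) * b0' + (d1 - d) * b1' = 0 ->
  d0 * c0 * B00 + d0 * c1 * B01 + d1 * c0 * B10 + d1 * c1 * B11 -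
    d * c * (B00 + B01 + B10 + B11) =
  (d0 - d) * (c0 - c) * B00 + (d0 - d) * (c1 - c) * B01 +
  (d1 - d) * (c0 - c) * B10 + (d1 - d) * (c1 - c) * B11 +
  d * ((c0 - c) * w0 + (c1 - c) * w1) + c * ((d0 - d) * w0' + (d1 - d) * w1').
Proof.
move=> e1 e2 e3 e4 h1 h2.
have -> : w0 = B00 + B10 + k * b0 by rewrite e1 subrK.
have -> : w1 = B01 + B11 + k * b1 by rewrite e2 subrK.
have -> : w0' = B00 + B01 + k' * b0' by rewrite e3 subrK.
have -> : w1' = B10 + B11 + k' * b1' by rewrite e4 subrK.
apply/eqP; rewrite -subr_eq0; apply/eqP.
(* The multiples k and k' of the b's only meet the two sums that vanish by hypothesis. *)
transitivity (- (d * k * ((c0 - c) * b0 + (c1 - c) * b1) +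
    c * k' * ((d0 - d) * b0' + (d1 - d) * b1'))); first by ring.
by rewrite h1 h2; ring.
Qed.

Lemma ratio_diff_sum0 (f0 f1 b0 b1 : R[i]) : b0 != 0 -> b1 != 0 -> b0 + b1 != 0 ->
  (f0 / b0 - (f0 + f1) / (b0 + b1)) * b0 +
  (f1 / b1 - (f0 + f1) / (b0 + b1)) * b1 = 0.
Proof. by move=> h0 h1 h; field; rewrite h0 h1 h. Qed.

(** Every product of two Haar quantities is split into squares by Young's inequality. The constant
    1024 is 4 times 256, and 512 is 4 times 64 times the 2 of [T2]. *)
Lemma remainder_arith (ef eg eb eb' ew ew' F G l L W p q : R) :
  0 <= L -> 0 <= W -> 0 <= l ->
  p = ef + F * eb -> q = eg + G * eb' ->
  4 * (256 * L ^+ 2 * W * (q * p / l)) +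
    4 * G * (64 * L ^+ 2 * p * (ew + eb) / l) +
    4 * F * (64 * L ^+ 2 * q * (ew' + eb') / l) <=
  (1024 * L ^+ 2 * W + 512 * L ^+ 2) *
    (ef ^+ 2 / l + eg ^+ 2 / l + (F ^+ 2 + G ^+ 2) *
      (eb ^+ 2 / l + eb' ^+ 2 / l + ew ^+ 2 / l + ew' ^+ 2 / l)).
Proof.
move=> L0 W0 l0 pE qE.
have P1 : p ^+ 2 <= 2 * (ef ^+ 2 + F ^+ 2 * eb ^+ 2).
  by rewrite pE; clear; have := sqr_ge0 (ef - F * eb); lra.
have Q1 : q ^+ 2 <= 2 * (eg ^+ 2 + G ^+ 2 * eb' ^+ 2).
  by rewrite qE; clear; have := sqr_ge0 (eg - G * eb'); lra.
have pq : q * p <= (p ^+ 2 + q ^+ 2) / 2.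
  by clear; have := sqr_ge0 (p - q); lra.
have S (y H u v : R) : H * y * (u + v) <= y ^+ 2 / 2 + H ^+ 2 * (u ^+ 2 + v ^+ 2).
  by clear; have := sqr_ge0 (y - H * (u + v)); have := sqr_ge0 (H * (u - v)); lra.
have S1 := S p G ew eb; have S2 := S q F ew' eb'.
pose T := ef ^+ 2 + eg ^+ 2 +
  (F ^+ 2 + G ^+ 2) * (eb ^+ 2 + eb' ^+ 2 + ew ^+ 2 + ew' ^+ 2).
have sq2 (x y : R) : 0 <= x ^+ 2 * y ^+ 2 by rewrite mulr_ge0 ?sqr_ge0.
have T1 : q * p <= T.
  have := sq2 F eb'; have := sq2 F ew; have := sq2 F ew'.
  have := sq2 G eb; have := sq2 G ew; have := sq2 G ew'.
  by rewrite /T; clear -pq P1 Q1; lra.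
have T2 : G * p * (ew + eb) + F * q * (ew' + eb') <= 2 * T.
  have := sq2 F ew; have := sq2 G ew'.
  have := sq2 F eb'; have := sq2 G eb; have := sq2 F eb; have := sq2 G eb'.
  have := sq2 G ew; have := sq2 F ew'.
  have := sqr_ge0 ef; have := sqr_ge0 eg.
  by rewrite /T; clear -S1 S2 P1 Q1; lra.
have i0 : 0 <= l^-1 by rewrite invr_ge0.
have L2 : 0 <= L ^+ 2 by exact: sqr_ge0.
have U1 := ler_wpM2l (mulr_ge0 (mulr_ge0 L2 W0) i0) T1.
have U2 := ler_wpM2l (mulr_ge0 L2 i0) T2.
rewrite (_ : ef ^+ 2 / l + _ + _ = T * l^-1); last by rewrite /T; ring.
by move: T U1 U2 {T1 T2 pE qE P1 Q1 S1 S2} => T U1 U2; lra.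
Qed.

(** Here l is the length of the parent, so that l / 8 is the stopping threshold at a child. By
    [remainder_identity] the ratio differences occur either in pairs or paired with w, and both are
    quadratic in Haar differences, the latter by [mean_ratio_pairing]. *)
Lemma remainder_bound (f0 f1 b0 b1 w0 w1 g0 g1 b0' b1' w0' w1'
    B00 B01 B10 B11 k k' : R[i]) (l L F G W : R) :
  0 < l -> 1 <= L -> 0 <= W -> 0 <= F -> 0 <= G ->
  l / 8 <= cabs b0 -> l / 8 <= cabs b1 -> l / 4 <= cabs (b0 + b1) ->
  l / 8 <= cabs b0' -> l / 8 <= cabs b1' -> l / 4 <= cabs (b0' + b1') ->
  cabs (b0 + b1) <= L * l -> cabs (w0 + w1) <= L * l -> cabs (f0 + f1) <= F * l ->
  cabs (b0' + b1') <= L * l -> cabs (w0' + w1') <= L * l ->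
  cabs (g0 + g1) <= G * l ->
  cabs B00 <= W * l -> cabs B01 <= W * l -> cabs B10 <= W * l ->
  cabs B11 <= W * l ->
  B00 + B10 = w0 - k * b0 -> B01 + B11 = w1 - k * b1 ->
  B00 + B01 = w0' - k' * b0' -> B10 + B11 = w1' - k' * b1' ->
  let c := (f0 + f1) / (b0 + b1) in let d := (g0 + g1) / (b0' + b1') in
  let c0 := f0 / b0 in let c1 := f1 / b1 in
  let d0 := g0 / b0' in let d1 := g1 / b1' in
  cabs (d0 * c0 * B00 + d0 * c1 * B01 + d1 * c0 * B10 + d1 * c1 * B11 -
        d * c * (B00 + B01 + B10 + B11)) <=
  (1024 * L ^+ 2 * W + 512 * L ^+ 2) *
   (cabs (f0 - f1) ^+ 2 / l + cabs (g0 - g1) ^+ 2 / l +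
    (F ^+ 2 + G ^+ 2) * (cabs (b0 - b1) ^+ 2 / l + cabs (b0' - b1') ^+ 2 / l +
       cabs (w0 - w1) ^+ 2 / l + cabs (w0' - w1') ^+ 2 / l)).
Proof.
move=> l0 L1 W0 F0 G0 hb0 hb1 hb hb0' hb1' hb' hbL hwL hfF hbL' hwL' hgG.
move=> hB00 hB01 hB10 hB11 e1 e2 e3 e4 /=.
set c := (f0 + f1) / _; set d := (g0 + g1) / _.
set c0 := f0 / _; set c1 := f1 / _; set d0 := g0 / _; set d1 := g1 / _.
have b0N : b0 != 0 by apply: cabs_gt0_neq0 hb0; lra.
have b1N : b1 != 0 by apply: cabs_gt0_neq0 hb1; lra.
have bN : b0 + b1 != 0 by apply: cabs_gt0_neq0 hb; lra.
have b0N' : b0' != 0 by apply: cabs_gt0_neq0 hb0'; lra.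
have b1N' : b1' != 0 by apply: cabs_gt0_neq0 hb1'; lra.
have bN' : b0' + b1' != 0 by apply: cabs_gt0_neq0 hb'; lra.
rewrite (remainder_identity e1 e2 e3 e4 (ratio_diff_sum0 _ _ b0N b1N bN)
  (ratio_diff_sum0 _ _ b0N' b1N' bN')) -/c -/d -/c0 -/c1 -/d0 -/d1.
have L0 : 0 <= L by lra.
have swap (x y : R[i]) : cabs (x - y) = cabs (y - x) by rewrite -opprB cabsN.
pose p := cabs (f0 - f1) + F * cabs (b0 - b1).
pose q := cabs (g0 - g1) + G * cabs (b0' - b1').
have p0 : 0 <= p by rewrite addr_ge0 ?mulr_ge0 ?cabs_ge0.
have q0 : 0 <= q by rewrite addr_ge0 ?mulr_ge0 ?cabs_ge0.
have dc0 : cabs (c0 - c) <= 16 * L * p / l by exact: mean_ratio_diff.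
have dc1 : cabs (c1 - c) <= 16 * L * p / l.
  rewrite /c1 /c /p (addrC f0) (addrC b0) (swap f0) (swap b0).
  by apply: mean_ratio_diff; rewrite // addrC.
have dd0 : cabs (d0 - d) <= 16 * L * q / l by exact: mean_ratio_diff.
have dd1 : cabs (d1 - d) <= 16 * L * q / l.
  rewrite /d1 /d /q (addrC g0) (addrC b0') (swap g0) (swap b0').
  by apply: mean_ratio_diff; rewrite // addrC.
have X1 := mean_ratio_pairing l0 L1 hb0 hb1 hb hbL hwL hfF.
have X2 := mean_ratio_pairing l0 L1 hb0' hb1' hb' hbL' hwL' hgG.
rewrite -/p -/q -/c -/d -/c0 -/c1 -/d0 -/d1 in X1 X2.
have cF : cabs c <= 4 * F.
  have := cabs_div_le (divr_gt0 l0 (ltr0n _ 4)) hfF hb.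
  by rewrite (_ : F * l / (l / 4) = 4 * F)//; field; rewrite gt_eqF.
have dG : cabs d <= 4 * G.
  have := cabs_div_le (divr_gt0 l0 (ltr0n _ 4)) hgG hb'.
  by rewrite (_ : G * l / (l / 4) = 4 * G)//; field; rewrite gt_eqF.
have Y x y z : cabs x <= 16 * L * q / l -> cabs y <= 16 * L * p / l ->
    cabs z <= W * l -> cabs (x * y * z) <= 256 * L ^+ 2 * W * (q * p / l).
  move=> hx hy hz; apply: le_trans (cabs_mul_le (cabs_mul_le hx hy) hz) _.
  by rewrite le_eqVlt; apply/orP; left; apply/eqP; field; rewrite gt_eqF.
have Y00 := Y _ _ _ dd0 dc0 hB00; have Y01 := Y _ _ _ dd0 dc1 hB01.
have Y10 := Y _ _ _ dd1 dc0 hB10; have Y11 := Y _ _ _ dd1 dc1 hB11.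
have Z1 := cabs_mul_le dG X1; have Z2 := cabs_mul_le cF X2.
have key := remainder_arith (cabs (w0 - w1)) (cabs (w0' - w1')) L0 W0 (ltW l0)
  (erefl p) (erefl q).
set A00 := _ * B00; set A01 := _ * B01; set A10 := _ * B10; set A11 := _ * B11.
set E1 := d * _; set E2 := c * _.
have tri : cabs (A00 + A01 + A10 + A11 + E1 + E2) <=
    cabs A00 + cabs A01 + cabs A10 + cabs A11 + cabs E1 + cabs E2.
  by do 5![rewrite (le_trans (cabsD _ _))// lerD//].
apply: le_trans tri _.
apply: le_trans key.
rewrite -/A00 -/A01 -/A10 -/A11 -/E1 -/E2 in Y00 Y01 Y10 Y11 Z1 Z2.
clear -Y00 Y01 Y10 Y11 Z1 Z2; lra.
Qed.

End Remainder.

(** * Matrices of perfect dyadic operators *)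

Section Kernel.
Variables (R : realType) (n : nat).
Implicit Types (k : seq bool -> seq bool -> R[i]) (u v : seq bool -> R[i]).

(** The conditions (c), (b), (a) read on leaves. Since the entries are constant on products of
    siblings, the size bound is stated for siblings, with their length in place of the distance. *)
Definition perfect_matrix (A : R) k : Prop :=
  [/\ forall i, size i = n -> k i i = 0,
      forall s i i' j, size i = n -> size i' = n -> size j = n ->
        suffix s i -> suffix s i' -> ~~ suffix s j ->
        k i j = k i' j /\ k j i = k j i' &
      forall m s c i j, (m + size (c :: s))%N = n -> size i = n -> size j = n ->
        suffix (c :: s) i -> suffix (~~ c :: s) j -> cabs (k i j) <= A / 2 ^+ m].

Definition mat_op k u (i : seq bool) : R[i] := dsum n [::] (fun j => k i j * u j).

(** The pairing of T(u 1_t) with v 1_s: the first node is the one on which the image is tested. *)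
Definition kform k m s t u v : R[i] :=
  dsum m s (fun i => v i * dsum m t (fun j => k i j * u j)).

Lemma perfect_matrix_tr A k :
  perfect_matrix A k -> perfect_matrix A (fun i j => k j i).
Proof.
move=> [k0 kc kA]; split=> //.
  by move=> s i i' j si si' sj ssi ssi' ssj; have [] := kc s i i' j.
move=> m s c i j ms si sj ci cj; apply: (kA m s (~~ c)) => //.
by rewrite negbK.
Qed.

Lemma kform_tr k m s t u v : kform k m s t u v = kform (fun i j => k j i) m t s v u.
Proof.
rewrite /kform; under eq_fun do rewrite -dsumZ.
rewrite dsum_exchange; apply: eq_dsum => j _ _.
by rewrite -dsumZ; apply: eq_dsum => i _ _; ring.
Qed.

Lemma kform_split k m s u v : kform k m.+1 s s u v =
  kform k m (false :: s) (false :: s) u v + kform k m (false :: s) (true :: s) u v +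
  kform k m (true :: s) (false :: s) u v + kform k m (true :: s) (true :: s) u v.
Proof.
have D s' (x y : seq bool -> R[i]) :
    dsum m s' (fun i => v i * (x i + y i)) =
    dsum m s' (fun i => v i * x i) + dsum m s' (fun i => v i * y i).
  by rewrite -dsumD; apply: eq_dsum => i _ _; rewrite mulrDr.
by rewrite /kform /= !D addrA.
Qed.

Lemma dsum_all_sub m s (f : seq bool -> R[i]) : (m + size s = n)%N ->
  dsum n [::] (fun i => if suffix s i then f i else 0) = dsum m s f.
Proof. by move=> <-; rewrite addnC; have := dsum_sub m [::] s f; rewrite !cats0. Qed.

Lemma mat_op_supp k m s u i : (m + size s = n)%N ->
  (forall j, ~~ suffix s j -> u j = 0) ->
  mat_op k u i = dsum m s (fun j => k i j * u j).
Proof.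
move=> ms us; rewrite -dsum_all_sub// /mat_op; apply: eq_dsum => j _ _.
by case: ifPn => // /us ->; rewrite mulr0.
Qed.

Variables (A : R) (k : seq bool -> seq bool -> R[i]).
Hypothesis kP : perfect_matrix A k.
Let kt i j := k j i.

(** On a product of siblings the matrix has a single entry, so the form factors through the two
    sums. *)
Lemma kform_cross m s c : (m.+1 + size s = n)%N ->
  exists2 a, cabs a <= A / 2 ^+ m &
  forall u v, kform k m (c :: s) (~~ c :: s) u v =
    a * (dsum m (c :: s) v * dsum m (~~ c :: s) u).
Proof.
case: kP => _ kc kA ms; have ms' d : (m + size (d :: s) = n)%N by rewrite /= addnS.
(* The leftmost leaf below [d :: s] serves as sample point. *)
pose i0 d := nseq m false ++ d :: s.
have si0 d : size (i0 d) = n by rewrite size_cat size_nseq ms'.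
have ssi0 d : suffix (d :: s) (i0 d) by exact: suffix_suffix.
have disj d t : suffix (d :: s) t -> ~~ suffix (~~ d :: s) t.
  move=> /suffixP[v ->]; apply/negP => /suffixP[w].
  move/(congr1 rev); rewrite !rev_cat !rev_cons !cat_rcons.
  by move/eqP; rewrite eqseq_cat// => /andP[_ /eqP[]]; case: d.
exists (k (i0 c) (i0 (~~ c))); first by apply: (kA m s c).
move=> u v; set a := k _ _.
transitivity (dsum m (c :: s) (fun i => a * dsum m (~~ c :: s) u * v i)); last first.
  by rewrite dsumZ; ring.
apply: eq_dsum => i si ssi; rewrite mulrC; congr (_ * _).
rewrite -dsumZ; apply: eq_dsum => j sj ssj; congr (_ * _); rewrite /a.
have {}si : size i = n by rewrite si ms'.
have {}sj : size j = n by rewrite sj ms'.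
have d1 : ~~ suffix (c :: s) j by have := disj (~~ c) _ ssj; rewrite negbK.
have [-> _] := kc (c :: s) i (i0 c) j si (si0 _) sj ssi (ssi0 _) d1.
by have [_ ->] := kc (~~ c :: s) j (i0 (~~ c)) (i0 c) sj (si0 _) (si0 _) ssj
  (ssi0 _) (disj _ _ (ssi0 _)).
Qed.

(* The part of the image of v coming from outside s is constant on s. *)
Lemma mat_op_local m s v : (m + size s = n)%N ->
  exists a, forall j, size j = n -> suffix s j ->
  dsum m s (fun i => k i j * v i) = mat_op kt v j - a.
Proof.
case: kP => _ kc _ ms.
pose out j := dsum n [::] (fun i => if suffix s i then 0 else k i j * v i).
pose j0 := nseq m false ++ s; exists (out j0) => j sj ssj.
have -> : out j0 = out j.
  apply: eq_dsum => i; rewrite addn0 => si _; case: ifPn => // nsi.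
  have sj0 : size j0 = n by rewrite size_cat size_nseq.
  by have [_ ->] := kc s j j0 i sj sj0 si ssj (suffix_suffix _ _) nsi.
rewrite -dsum_all_sub// /mat_op -dsumB; apply: eq_dsum => i _ _.
by case: ifP; rewrite ?subr0 // subrr.
Qed.

(** Moving the operator to v, the part of its image coming from outside [s] contributes a multiple
    of the sum of u. This multiple is the same for both children, as [remainder_identity] requires
    of k and k'. *)
Lemma kform_row m s u v : (m.+1 + size s = n)%N ->
  exists a, forall c,
  kform k m (false :: s) (c :: s) u v + kform k m (true :: s) (c :: s) u v =
  dsum m (c :: s) (fun j => u j * mat_op kt v j) - a * dsum m (c :: s) u.
Proof.
move=> ms; have [a ha] := mat_op_local v ms; exists a => c.
rewrite -dsumZ -dsumB.
transitivity (dsum m.+1 s (fun i => dsum m (c :: s) (fun j => v i * (k i j * u j)))).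
  by rewrite /=; congr (_ + _); apply: eq_dsum => i _ _; rewrite dsumZ.
rewrite dsum_exchange; apply: eq_dsum => j sj ssj.
have {}sj : size j = n by rewrite sj /= addnS.
have {}ssj : suffix s j by exact: suffix_trans (suffix_cons _ _) ssj.
rewrite [a * _]mulrC -mulrBr -ha// -dsumZ.
by apply: eq_dsum => i _ _; ring.
Qed.

(** The constant left by [mat_op_local] is killed by the mean of u. *)
Lemma kform_mean0 m s u v : (m + size s = n)%N -> dsum m s u = 0 ->
  kform k m s s u v = dsum m s (fun j => u j * mat_op kt v j).
Proof.
move=> ms u0; have [a ha] := mat_op_local v ms.
rewrite kform_tr /kform.
rewrite (@eq_dsum _ _ _ _ (fun j => u j * mat_op kt v j - a * u j)).
  by rewrite dsumB dsumZ u0 mulr0 subr0.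
by move=> j sj ssj; rewrite ha ?sj//; ring.
Qed.

(* Subtracting a multiple of u0 makes u of mean zero, so that its image is
   supported in s and may be moved to the other side. *)
Lemma kform_diag m s u u0 v : (m + size s = n)%N ->
  dsum m s u0 = 2 ^+ m -> (forall j, ~~ suffix s j -> u0 j = 0) ->
  let a := dsum m s u / 2 ^+ m in
  kform k m s s u v = a * dsum m s (fun i => v i * mat_op k u0 i) +
    (dsum m s (fun j => u j * mat_op kt v j) -
     a * dsum m s (fun j => u0 j * mat_op kt v j)).
Proof.
move=> ms u01 u0s /=; set a := _ / _.
have -> : dsum m s (fun i => v i * mat_op k u0 i) = kform k m s s u0 v.
  by apply: eq_dsum => i _ _; rewrite (mat_op_supp _ _ ms u0s).
have <- : kform k m s s (fun j => u j - a * u0 j) v =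
    dsum m s (fun j => u j * mat_op kt v j) -
    a * dsum m s (fun j => u0 j * mat_op kt v j).
  rewrite kform_mean0//.
    by rewrite -dsumZ -dsumB; apply: eq_dsum => j _ _; ring.
  by rewrite dsumB dsumZ u01 /a divfK ?subrr// expf_neq0// pnatr_eq0.
rewrite /kform -dsumZ -dsumD; apply: eq_dsum => i _ _.
rewrite -!dsumZ -dsumD; apply: eq_dsum => j _ _; ring.
Qed.

End Kernel.

(** * The local Tb theorem for matrices *)

Section LocalTb.
Variables (R : realType) (n : nat) (A B : R) (k : seq bool -> seq bool -> R[i]).
Variables b1 b2 : seq bool -> seq bool -> R[i].
Let kt i j := k j i.
Let h1 a := mat_op n k (b1 a).
Let h2 a := mat_op n kt (b2 a).
Let L : R := 4 * B ^+ 2.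
Hypothesis A0 : 0 <= A.
Hypothesis B1 : 1 <= B.
Hypothesis kP : perfect_matrix n A k.
Hypothesis b1_supp : forall s j, ~~ suffix s j -> b1 s j = 0.
Hypothesis b1_sum : forall m s, (m + size s = n)%N -> dsum m s (b1 s) = 2 ^+ m.
Hypothesis b2_sum : forall m s, (m + size s = n)%N -> dsum m s (b2 s) = 2 ^+ m.
Hypothesis b1_energy : forall m s, (m + size s = n)%N ->
  energy b1 h1 s m s <= B * 2 ^+ m.
Hypothesis b2_energy : forall m s, (m + size s = n)%N ->
  energy b2 h2 s m s <= B * 2 ^+ m.

Let a1 := anchor n L b1 h1.
Let a2 := anchor n L b2 h2.
Let W1 s := b1 (a1 s).
Let W2 s := b2 (a2 s).
Let V1 s t := W1 s t * h2 (a2 s) t.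
Let V2 s t := W2 s t * h1 (a1 s) t.
Let stop s := changes n L b1 h1 s || changes n L b2 h2 s.

Let L1 : 1 <= L. Proof. by rewrite /L; have := B1; nra. Qed.
Let L0 : 0 <= L. Proof. by have := L1; lra. Qed.
Let BL : B <= L. Proof. by rewrite /L; have := B1; nra. Qed.
Let l0 m : 0 < 2 ^+ m :> R. Proof. by rewrite exprn_gt0. Qed.

Let pair_bound m s (u v : seq bool -> R[i]) :
  dsum m s (fun t => cabs (u t) ^+ 2) <= L * 2 ^+ m ->
  dsum m s (fun t => cabs (v t) ^+ 2) <= L * 2 ^+ m ->
  cabs (dsum m s (fun t => u t * v t)) <= L * 2 ^+ m.
Proof. by move=> hu hv; rewrite (le_trans (cabs_dsumM _ _ _ _))//; lra. Qed.

Let sum_bound m s (u : seq bool -> R[i]) :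
  dsum m s (fun t => cabs (u t) ^+ 2) <= L * 2 ^+ m ->
  cabs (dsum m s u) <= L * 2 ^+ m.
Proof.
move=> hu; rewrite (@eq_dsum _ m s u (fun t => u t * 1)).
  apply: pair_bound => //; under eq_fun do rewrite cabs1 expr1n.
  by rewrite dsum_const mulr1 ler_peMl// ltW.
by move=> t _ _; rewrite mulr1.
Qed.

Let energy_b (b h : seq bool -> seq bool -> R[i]) a m s c :
  energy b h a m s <= c -> dsum m s (fun t => cabs (b a t) ^+ 2) <= c.
Proof.
by apply: le_trans; apply: ler_dsum => t _ _; rewrite lerDl sqr_ge0.
Qed.

Let energy_h (b h : seq bool -> seq bool -> R[i]) a m s c :
  energy b h a m s <= c -> dsum m s (fun t => cabs (h a t) ^+ 2) <= c.
Proof.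
by apply: le_trans; apply: ler_dsum => t _ _; rewrite lerDr sqr_ge0.
Qed.

Let good1 m s : (m + size s = n)%N ->
  2 ^+ m / 4 <= cabs (dsum m s (W1 s)) /\ energy b1 h1 (a1 s) m s <= L * 2 ^+ m.
Proof.
move=> ms; have := good_anchor B1 (erefl L) b1_sum b1_energy ms.
by rewrite (goodE _ _ _ _ ms) => /andP[].
Qed.

Let good2 m s : (m + size s = n)%N ->
  2 ^+ m / 4 <= cabs (dsum m s (W2 s)) /\ energy b2 h2 (a2 s) m s <= L * 2 ^+ m.
Proof.
move=> ms; have := good_anchor B1 (erefl L) b2_sum b2_energy ms.
by rewrite (goodE _ _ _ _ ms) => /andP[].
Qed.

Let W1_le m s : (m + size s = n)%N -> cabs (dsum m s (W1 s)) <= L * 2 ^+ m.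
Proof. by move=> /good1[_ e]; exact: sum_bound (energy_b e). Qed.

Let W2_le m s : (m + size s = n)%N -> cabs (dsum m s (W2 s)) <= L * 2 ^+ m.
Proof. by move=> /good2[_ e]; exact: sum_bound (energy_b e). Qed.

Let V1_le m s : (m + size s = n)%N -> cabs (dsum m s (V1 s)) <= L * 2 ^+ m.
Proof.
move=> ms; have [_ e1] := good1 ms; have [_ e2] := good2 ms.
exact: pair_bound (energy_b e1) (energy_h e2).
Qed.

Let V2_le m s : (m + size s = n)%N -> cabs (dsum m s (V2 s)) <= L * 2 ^+ m.
Proof.
move=> ms; have [_ e1] := good1 ms; have [_ e2] := good2 ms.
exact: pair_bound (energy_b e2) (energy_h e1).
Qed.

(** The part 2 L^2 + L serves the diagonal forms in [kform_le], and A L^2 the forms between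
    siblings. *)
Let W : R := 2 * L ^+ 2 + L + A * L ^+ 2.
Let AL0 : 0 <= A * L ^+ 2. Proof. by rewrite mulr_ge0 ?sqr_ge0. Qed.
Let W0 : 0 <= W.
Proof. by rewrite /W; have := AL0; have := sqr_ge0 L; have := L0; lra. Qed.

(** In [kform_diag] the auxiliary function is [b1 s], the test function of [s] itself; the three
    pairings that result are controlled by energies on [s]. *)
Let kform_le m s : (m + size s = n)%N ->
  cabs (kform k m s s (W1 s) (W2 s)) <= W * 2 ^+ m.
Proof.
move=> ms; rewrite (kform_diag kP (W1 s) (W2 s) ms (b1_sum ms) (b1_supp (s := s))).
have [_ e1] := good1 ms; have [_ e2] := good2 ms.
have e3 : energy b1 h1 s m s <= L * 2 ^+ m.
  by rewrite (le_trans (b1_energy ms))// ler_wpM2r ?BL// ltW.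
set c := _ / _; have cL : cabs c <= L.
  have := @cabs_div_le _ _ (2 ^+ m) _ _ (l0 m) (W1_le ms).
  by rewrite cabs_exp2 lexx mulfK ?gt_eqF//; apply.
have p1 := cabs_mul_le cL (pair_bound (energy_b e2) (energy_h e3)).
have p2 := pair_bound (energy_b e1) (energy_h e2).
have p3 := cabs_mul_le cL (pair_bound (energy_b e3) (energy_h e2)).
rewrite (le_trans (cabsD _ _))// (le_trans (lerD p1 (cabsB _ _)))//.
rewrite (le_trans (lerD (lexx _) (lerD p2 p3)))// /W.
by have := mulr_ge0 AL0 (ltW (l0 m)); lra.
Qed.

Let stop_packing m s : (m + size s = n)%N ->
  nsum m s (fun p t => if stop t then 2 ^+ p else 0) <= 16 * B * 2 ^+ m.
Proof.
move=> ms.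
have := stopping_packing B1 (erefl L) b1_sum b1_energy ms.
have := stopping_packing B1 (erefl L) b2_sum b2_energy ms.
suff : nsum m s (fun p t => if stop t then 2 ^+ p else 0) <=
    nsum m s (fun p t => if changes n L b1 h1 t then 2 ^+ p else 0) +
    nsum m s (fun p t => if changes n L b2 h2 t then 2 ^+ p else 0) :> R by lra.
rewrite -nsumD; apply: ler_nsum => p t _; rewrite /stop.
have := l0 p; case: (changes n L b1 h1 t); case: (changes n L b2 h2 t) => /=; lra.
Qed.

Let nstop s c : ~~ stop s -> a1 (c :: s) = a1 s /\ a2 (c :: s) = a2 s.
Proof. by rewrite negb_or => /andP[? ?]; split; apply: changesF. Qed.

(** The Carleson sequence that weights the squared means of |f| and |g| in the remainder. *)
Let gam (p : nat) s : R :=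
  if stop s then 2 ^+ p else
  cabs (hdiff p s (W1 s)) ^+ 2 / 2 ^+ p + cabs (hdiff p s (W2 s)) ^+ 2 / 2 ^+ p +
  cabs (hdiff p s (V1 s)) ^+ 2 / 2 ^+ p + cabs (hdiff p s (V2 s)) ^+ 2 / 2 ^+ p.

Let gam_ge0 p s : 0 <= gam p s.
Proof.
have q (z : R[i]) : 0 <= cabs z ^+ 2 / 2 ^+ p.
  by rewrite divr_ge0 ?sqr_ge0// ltW.
by rewrite /gam; case: ifP => _; [rewrite ltW|rewrite !addr_ge0].
Qed.

(** 16 B accounts for the stopping nodes, and the four other summands for the square functions of
    [W1], [W2], [V1], [V2]. *)
Let Lam : R := 16 * B + 4 * (L ^+ 2 * (1 + 16 * B)).
Let Lam0 : 0 < Lam.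
Proof.
have := B1; have : 0 <= L ^+ 2 * (1 + 16 * B).
  by rewrite mulr_ge0 ?sqr_ge0//; have := B1; lra.
by rewrite /Lam; lra.
Qed.

Let gam_packing m s : (m + size s = n)%N -> nsum m s gam <= Lam * 2 ^+ m.
Proof.
move=> ms; have st := stop_packing ms.
have sq V (Vc : forall c t, ~~ stop t -> V (c :: t) = V t)
    (VL : forall m s, (m + size s = n)%N -> cabs (dsum m s (V s)) <= L * 2 ^+ m) :=
  square_function L0 Vc VL stop_packing ms.
have q1 := sq W1 (fun c t st => congr1 b1 (proj1 (nstop c st))) W1_le.
have q2 := sq W2 (fun c t st => congr1 b2 (proj2 (nstop c st))) W2_le.
(* [V1] and [V2] mix the two systems, hence persist only where neither anchor changes; for this
   reason [stop] joins both stopping conditions. *)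
have V1c c t : ~~ stop t -> V1 (c :: t) = V1 t.
  by move=> /(nstop c)[e1 e2]; rewrite /V1 /W1 e1 e2.
have V2c c t : ~~ stop t -> V2 (c :: t) = V2 t.
  by move=> /(nstop c)[e1 e2]; rewrite /V2 /W2 e1 e2.
have q3 := sq V1 V1c V1_le; have q4 := sq V2 V2c V2_le.
rewrite (_ : Lam * 2 ^+ m = 16 * B * 2 ^+ m +
  (L ^+ 2 * (1 + 16 * B) * 2 ^+ m + L ^+ 2 * (1 + 16 * B) * 2 ^+ m +
   L ^+ 2 * (1 + 16 * B) * 2 ^+ m + L ^+ 2 * (1 + 16 * B) * 2 ^+ m)); last first.
  by rewrite /Lam; ring.
apply: le_trans (lerD st (lerD (lerD (lerD q1 q2) q3) q4)).
rewrite -!nsumD; apply: ler_nsum => p t _; rewrite /gam.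
by case: ifP => _; lra.
Qed.

Variables f g : seq bool -> R[i].
Let F m s := dsum m s (fun t => cabs (f t)) / 2 ^+ m.
Let G m s := dsum m s (fun t => cabs (g t)) / 2 ^+ m.
Let cf m s := dsum m s f / dsum m s (W1 s).
Let dg m s := dsum m s g / dsum m s (W2 s).
(** The pairing of T f_P with g_P, for the f_P and g_P of the overview. *)
Let Y m s := dg m s * cf m s * kform k m s s (W1 s) (W2 s).

Let F0 m s : 0 <= F m s.
Proof. by rewrite divr_ge0 ?dsum_ge0 ?ltW// => t; exact: cabs_ge0. Qed.
Let G0 m s : 0 <= G m s.
Proof. by rewrite divr_ge0 ?dsum_ge0 ?ltW// => t; exact: cabs_ge0. Qed.
Let fF m s : cabs (dsum m s f) <= F m s * 2 ^+ m.
Proof. by rewrite /F divfK ?gt_eqF// cabs_dsum. Qed.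
Let gG m s : cabs (dsum m s g) <= G m s * 2 ^+ m.
Proof. by rewrite /G divfK ?gt_eqF// cabs_dsum. Qed.

Let cf_le m s : (m + size s = n)%N -> cabs (cf m s) <= 4 * F m s.
Proof.
move=> ms; have [lo _] := good1 ms.
have := cabs_div_le (divr_gt0 (l0 m) (ltr0n _ 4)) (fF m s) lo.
by rewrite (_ : F m s * _ / _ = 4 * F m s)//; field; rewrite gt_eqF.
Qed.

Let dg_le m s : (m + size s = n)%N -> cabs (dg m s) <= 4 * G m s.
Proof.
move=> ms; have [lo _] := good2 ms.
have := cabs_div_le (divr_gt0 (l0 m) (ltr0n _ 4)) (gG m s) lo.
by rewrite (_ : G m s * _ / _ = 4 * G m s)//; field; rewrite gt_eqF.
Qed.

Let Y_le m s : (m + size s = n)%N ->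
  cabs (Y m s) <= 16 * W * (F m s * G m s) * 2 ^+ m.
Proof.
move=> ms.
have := cabs_mul_le (cabs_mul_le (dg_le ms) (cf_le ms)) (kform_le ms).
by move/le_trans; apply; lra.
Qed.

Let mean_child m c s (u : seq bool -> R[i]) :
  dsum m (c :: s) (fun t => cabs (u t)) / 2 ^+ m <=
  2 * (dsum m.+1 s (fun t => cabs (u t)) / 2 ^+ m.+1).
Proof.
rewrite ler_pdivrMr// exprS.
rewrite (_ : 2 * _ * _ = dsum m.+1 s (fun t => cabs (u t))); last first.
  by field; rewrite gt_eqF.
by case: c => /=; rewrite ?lerDl ?lerDr dsum_ge0// => t; exact: cabs_ge0.
Qed.

(** The error of one telescoping step. The cross terms carry f and g themselves, as these forms
    depend only on the sums over the children. *)
Let Rem m s : R[i] :=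
  kform k m (false :: s) (true :: s) f g + kform k m (true :: s) (false :: s) f g
  - Y m.+1 s + Y m (false :: s) + Y m (true :: s).

Let K : R := 2 * A + 40 * W + (1024 * L ^+ 2 * W + 512 * L ^+ 2).

(** All five terms are bounded separately, the means of |f| and |g| over a child being at most twice
    those over [s]. The cross terms give 2A, and [Y] at the node and its children gives 40 W. *)
Let Rem_stop m s : (m.+1 + size s = n)%N ->
  cabs (Rem m s) <=
  (2 * A + 40 * W) * ((F m.+1 s ^+ 2 + G m.+1 s ^+ 2) * 2 ^+ m.+1).
Proof.
move=> ms; have ms' c : (m + size (c :: s) = n)%N by rewrite /= addnS.
set X := F m.+1 s; set Z := G m.+1 s.
have X0 : 0 <= X := F0 _ _; have Z0 : 0 <= Z := G0 _ _.
have AX : 0 <= X * Z by rewrite mulr_ge0.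
have cross c : cabs (kform k m (c :: s) (~~ c :: s) f g) <=
    4 * A * (X * Z) * 2 ^+ m.
  have [a aA ->] := kform_cross kP c ms.
  have Fc d : cabs (dsum m (d :: s) f) <= 2 * X * 2 ^+ m.
    exact: le_trans (fF _ _) (ler_wpM2r (ltW (l0 m)) (mean_child _ _ _ _)).
  have Gc d : cabs (dsum m (d :: s) g) <= 2 * Z * 2 ^+ m.
    exact: le_trans (gG _ _) (ler_wpM2r (ltW (l0 m)) (mean_child _ _ _ _)).
  have := cabs_mul_le aA (cabs_mul_le (Gc c) (Fc (~~ c))).
  by rewrite (_ : A / _ * _ = 4 * A * (X * Z) * 2 ^+ m)//; field; rewrite gt_eqF.
have Yc c : cabs (Y m (c :: s)) <= 64 * W * (X * Z) * 2 ^+ m.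
  rewrite (le_trans (Y_le (ms' c)))//.
  have : F m (c :: s) * G m (c :: s) <= (2 * X) * (2 * Z).
    by rewrite ler_pM ?F0 ?G0 ?mean_child.
  move=> /(ler_wpM2l (mulr_ge0 W0 (ltW (l0 m)))).
  by lra.
have c0 := cross false; have c1 := cross true; rewrite /= in c0 c1.
have Y0 := Yc false; have Y1 := Yc true; have Yp := Y_le ms; rewrite -/X -/Z in Yp.
have tri : cabs (Rem m s) <= cabs (kform k m (false :: s) (true :: s) f g) +
    cabs (kform k m (true :: s) (false :: s) f g) + cabs (Y m.+1 s) +
    cabs (Y m (false :: s)) + cabs (Y m (true :: s)).
  rewrite /Rem (le_trans (cabsD _ _))// lerD// (le_trans (cabsD _ _))// lerD//.
  by rewrite (le_trans (cabsB _ _))// lerD// cabsD.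
apply: (le_trans tri).
have XZ : 2 * (X * Z) <= X ^+ 2 + Z ^+ 2 by have := sqr_ge0 (X - Z); lra.
have AW : 0 <= (2 * A + 40 * W) * 2 ^+ m.+1.
  by rewrite mulr_ge0 ?(ltW (l0 _))// addr_ge0 ?mulr_ge0.
have := ler_wpM2l AW XZ.
move: Yp; rewrite exprS; lra.
Qed.

Let Rem_nonstop m s : (m.+1 + size s = n)%N -> ~~ stop s ->
  cabs (Rem m s) <= (1024 * L ^+ 2 * W + 512 * L ^+ 2) *
   (cabs (hdiff m.+1 s f) ^+ 2 / 2 ^+ m.+1 + cabs (hdiff m.+1 s g) ^+ 2 / 2 ^+ m.+1 +
    (F m.+1 s ^+ 2 + G m.+1 s ^+ 2) * gam m.+1 s).
Proof.
move=> ms st; have ms' c : (m + size (c :: s) = n)%N by rewrite /= addnS.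
have W1c c : W1 (c :: s) = W1 s by rewrite /W1; have [-> _] := nstop c st.
have W2c c : W2 (c :: s) = W2 s by rewrite /W2; have [_ ->] := nstop c st.
have [lo1 _] := good1 ms; have [lo2 _] := good2 ms.
have lo1c c : 2 ^+ m.+1 / 8 <= cabs (dsum m (c :: s) (W1 s)).
  by have [] := good1 (ms' c); rewrite W1c exprS; lra.
have lo2c c : 2 ^+ m.+1 / 8 <= cabs (dsum m (c :: s) (W2 s)).
  by have [] := good2 (ms' c); rewrite W2c exprS; lra.
have N1 c : dsum m (c :: s) (W1 s) != 0.
  by apply: cabs_gt0_neq0 (lo1c c); rewrite divr_gt0.
have N2 c : dsum m (c :: s) (W2 s) != 0.
  by apply: cabs_gt0_neq0 (lo2c c); rewrite divr_gt0.
(* Between siblings, f and g may be replaced by the multiples of [W1 s] and [W2 s] having the same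
   sums over the children. *)
have crossE c : kform k m (c :: s) (~~ c :: s) f g =
    dg m (c :: s) * cf m (~~ c :: s) * kform k m (c :: s) (~~ c :: s) (W1 s) (W2 s).
  have [a _ ha] := kform_cross kP c ms; rewrite !ha /dg /cf W1c W2c.
  by field; rewrite N1 N2.
have Bdiag c : cabs (kform k m (c :: s) (c :: s) (W1 s) (W2 s)) <= W * 2 ^+ m.+1.
  have := kform_le (ms' c); rewrite W1c W2c exprS => /le_trans; apply.
  by have := mulr_ge0 W0 (ltW (l0 m)); lra.
have Bcross c : cabs (kform k m (c :: s) (~~ c :: s) (W1 s) (W2 s)) <= W * 2 ^+ m.+1.
  have [a aA ->] := kform_cross kP c ms.
  have w1 d : cabs (dsum m (d :: s) (W1 s)) <= L * 2 ^+ m.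
    by have := W1_le (ms' d); rewrite W1c.
  have w2 d : cabs (dsum m (d :: s) (W2 s)) <= L * 2 ^+ m.
    by have := W2_le (ms' d); rewrite W2c.
  apply: le_trans (cabs_mul_le aA (cabs_mul_le (w2 _) (w1 _))) _.
  rewrite (_ : _ * _ = A * L ^+ 2 * 2 ^+ m); last by field; rewrite gt_eqF.
  have := mulr_ge0 AL0 (ltW (l0 m)).
  have : 0 <= (2 * L ^+ 2 + L) * 2 ^+ m.
    by rewrite mulr_ge0 ?(ltW (l0 m))//; have := sqr_ge0 L; have := L0; lra.
  by rewrite /W [2 ^+ m.+1]exprS; lra.
have [a row] := kform_row kP (W1 s) (W2 s) ms.
have [a' col] := kform_row (perfect_matrix_tr kP) (W2 s) (W1 s) ms.
have {}col c : kform k m (c :: s) (false :: s) (W1 s) (W2 s) +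
    kform k m (c :: s) (true :: s) (W1 s) (W2 s) =
    dsum m (c :: s) (V2 s) - a' * dsum m (c :: s) (W2 s).
  rewrite (kform_tr k m (c :: s) (false :: s)) (kform_tr k m (c :: s) (true :: s)).
  exact: col.
have := remainder_bound (f0 := dsum m (false :: s) f) (f1 := dsum m (true :: s) f)
  (g0 := dsum m (false :: s) g) (g1 := dsum m (true :: s) g)
  (l0 m.+1) L1 W0 (F0 m.+1 s) (G0 m.+1 s)
  (lo1c false) (lo1c true) lo1 (lo2c false) (lo2c true) lo2
  (W1_le ms) (V1_le ms) (fF m.+1 s) (W2_le ms) (V2_le ms) (gG m.+1 s)
  (Bdiag false) (Bcross false) (Bcross true) (Bdiag true)
  (row false) (row true) (col false) (col true).
rewrite /gam (negPf st) /Rem /Y kform_split.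
have cE := crossE false; have cE' := crossE true; rewrite /= in cE cE'.
rewrite cE cE' {cE cE'} /cf /dg !W1c !W2c.
move=> bound; rewrite [X in cabs X](_ : _ =
  dsum m (false :: s) g / dsum m (false :: s) (W2 s) *
  (dsum m (false :: s) f / dsum m (false :: s) (W1 s)) *
  kform k m (false :: s) (false :: s) (W1 s) (W2 s) +
  dsum m (false :: s) g / dsum m (false :: s) (W2 s) *
  (dsum m (true :: s) f / dsum m (true :: s) (W1 s)) *
  kform k m (false :: s) (true :: s) (W1 s) (W2 s) +
  dsum m (true :: s) g / dsum m (true :: s) (W2 s) *
  (dsum m (false :: s) f / dsum m (false :: s) (W1 s)) *
  kform k m (true :: s) (false :: s) (W1 s) (W2 s) +
  dsum m (true :: s) g / dsum m (true :: s) (W2 s) *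
  (dsum m (true :: s) f / dsum m (true :: s) (W1 s)) *
  kform k m (true :: s) (true :: s) (W1 s) (W2 s) -
  dsum m.+1 s g / dsum m.+1 s (W2 s) * (dsum m.+1 s f / dsum m.+1 s (W1 s)) *
  (kform k m (false :: s) (false :: s) (W1 s) (W2 s) +
   kform k m (false :: s) (true :: s) (W1 s) (W2 s) +
   kform k m (true :: s) (false :: s) (W1 s) (W2 s) +
   kform k m (true :: s) (true :: s) (W1 s) (W2 s))); last by ring.
exact: bound.
Qed.

Let Rem_le m s : (m.+1 + size s = n)%N ->
  cabs (Rem m s) <= K *
   (cabs (hdiff m.+1 s f) ^+ 2 / 2 ^+ m.+1 + cabs (hdiff m.+1 s g) ^+ 2 / 2 ^+ m.+1 +
    (gam m.+1 s * F m.+1 s ^+ 2 + gam m.+1 s * G m.+1 s ^+ 2)).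
Proof.
move=> ms; rewrite -mulrDr [gam _ _ * _]mulrC.
set T := _ + _ / _; set Q := _ * gam _ _.
have T0 : 0 <= T by rewrite addr_ge0 ?divr_ge0 ?sqr_ge0 ?(ltW (l0 _)).
have Q0 : 0 <= Q by rewrite mulr_ge0 ?gam_ge0// addr_ge0 ?sqr_ge0.
have k1 : 0 <= 2 * A + 40 * W by have := A0; have := W0; lra.
have k2 : 0 <= 1024 * L ^+ 2 * W + 512 * L ^+ 2.
  by have := mulr_ge0 (sqr_ge0 L) W0; have := sqr_ge0 L; lra.
have [st|st] := boolP (stop s).
  apply: le_trans (Rem_stop ms) _.
  rewrite (_ : _ * 2 ^+ m.+1 = Q); last by rewrite /Q /gam st.
  have := mulr_ge0 k1 T0; have := mulr_ge0 k2 T0; have := mulr_ge0 k2 Q0.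
  by rewrite /K; lra.
apply: le_trans (Rem_nonstop ms st) _; rewrite -/T -/Q.
have := mulr_ge0 k1 T0; have := mulr_ge0 k1 Q0.
by rewrite /K; lra.
Qed.

(** Telescoping down the tree; at a leaf both forms vanish with the diagonal of [k]. *)
Let kform_expand m s : (m + size s = n)%N ->
  cabs (kform k m s s f g - Y m s) <=
  nsum m s (fun p t => if p is p'.+1 then cabs (Rem p' t) else 0).
Proof.
elim: m s => [|m IH] s ms.
  rewrite /Y /kform /=; case: kP => k0 _ _.
  by rewrite (k0 _ ms) !(mul0r, mulr0) subr0 cabs0.
have ms' c : (m + size (c :: s) = n)%N by rewrite /= addnS.
have -> : kform k m.+1 s s f g - Y m.+1 s = Rem m s +
    ((kform k m (false :: s) (false :: s) f g - Y m (false :: s)) +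
     (kform k m (true :: s) (true :: s) f g - Y m (true :: s))).
  by rewrite kform_split /Rem; ring.
by rewrite /= (le_trans (cabsD _ _))// lerD// (le_trans (cabsD _ _))// lerD ?IH.
Qed.

(** The Haar terms of [Rem_le] are summed by Parseval, the terms weighted by [gam] by the Carleson
    embedding, and the top term is bounded by Cauchy-Schwarz on the root. *)
Lemma bilinear_bound :
  cabs (dsum n [::] (fun i => g i * mat_op n k f i)) <=
  (8 * W + K * (1 + 4 * Lam)) *
  (dsum n [::] (fun i => cabs (f i) ^+ 2) + dsum n [::] (fun i => cabs (g i) ^+ 2)).
Proof.
have n0 : (n + size ([::] : seq bool) = n)%N by rewrite addn0.
set X := dsum n [::] (fun i => cabs (f i) ^+ 2).
set Z := dsum n [::] (fun i => cabs (g i) ^+ 2).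
have K0 : 0 <= K.
  rewrite /K; have := mulr_ge0 (sqr_ge0 L) W0; have := sqr_ge0 L.
  by have := A0; have := W0; lra.
have ff (u : seq bool -> R[i]) := haar_parseval n [::] u.
have top (u : seq bool -> R[i]) : 0 <= cabs (dsum n [::] u) ^+ 2 / 2 ^+ n.
  by rewrite divr_ge0 ?sqr_ge0 ?ltW.
have cF := carleson_embedding (fun t => cabs (f t)) Lam0 gam_ge0 gam_packing n0.
have cG := carleson_embedding (fun t => cabs (g t)) Lam0 gam_ge0 gam_packing n0.
have E1 : nsum n [::] (fun p t => if p is p'.+1 then cabs (Rem p' t) else 0) <=
    K * (X + Z + (4 * Lam * X + 4 * Lam * Z)).
  have : nsum n [::] (fun p t => if p is p'.+1 then cabs (Rem p' t) else 0) <=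
      nsum n [::] (fun p t => K *
       (cabs (hdiff p t f) ^+ 2 / 2 ^+ p + cabs (hdiff p t g) ^+ 2 / 2 ^+ p +
       (gam p t * F p t ^+ 2 + gam p t * G p t ^+ 2))).
    apply: ler_nsum => -[|p] t pt.
      apply: mulr_ge0 => //; apply: addr_ge0; apply: addr_ge0.
      - exact: divr_ge0 (sqr_ge0 _) (ltW (l0 _)).
      - exact: divr_ge0 (sqr_ge0 _) (ltW (l0 _)).
      - exact: mulr_ge0 (gam_ge0 _ _) (sqr_ge0 _).
      - exact: mulr_ge0 (gam_ge0 _ _) (sqr_ge0 _).
    by apply: Rem_le; rewrite pt addn0.
  move/le_trans; apply; rewrite nsumZ ler_wpM2l// !nsumD lerD// ?lerD//.
  - by have := ff f; have := top f; rewrite -/X; lra.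
  - by have := ff g; have := top g; rewrite -/Z; lra.
have E2 : cabs (Y n [::]) <= 8 * W * (X + Z).
  apply: le_trans (Y_le n0) _.
  have sq (u : seq bool -> R[i]) : (dsum n [::] (fun t => cabs (u t)) / 2 ^+ n) ^+ 2 * 2 ^+ n <=
      dsum n [::] (fun t => cabs (u t) ^+ 2).
    rewrite expr_div_n (expr2 (2 ^+ n)) invfM mulrA divfK ?gt_eqF//.
    by rewrite ler_pdivrMr// mulrC sqr_dsum_le.
  have := sq f; have := sq g; rewrite -/(F n [::]) -/(G n [::]) -/X -/Z.
  move: (F _ _) (G _ _) => x z hx hz.
  have xz : 2 * (x * z) <= x ^+ 2 + z ^+ 2 by have := sqr_ge0 (x - z); lra.
  have := ler_wpM2r (ltW (l0 n)) xz => h.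
  rewrite (_ : _ * _ = 8 * W * (2 * (x * z) * 2 ^+ n)); last by ring.
  by rewrite ler_wpM2l ?mulr_ge0//; lra.
have E3 := kform_expand n0.
rewrite -/(kform k n [::] [::] f g) -(subrK (Y n [::]) (kform _ _ _ _ _ _)).
by rewrite (le_trans (cabsD _ _))//; lra.
Qed.

End LocalTb.

(** [bilinear_bound] is tested on a small multiple of the conjugate of Tf; the energy of Tf on the
    right is then absorbed on the left. *)
Lemma local_Tb_matrix (R : realType) (A B : R) : 0 <= A -> 1 <= B ->
  exists2 C : R, 0 <= C & forall n (k b1 b2 : seq bool -> seq bool -> R[i]),
  let kt i j := k j i in
  perfect_matrix n A k ->
  (forall s j, ~~ suffix s j -> b1 s j = 0) ->
  (forall m s, (m + size s = n)%N -> dsum m s (b1 s) = 2 ^+ m) ->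
  (forall m s, (m + size s = n)%N -> dsum m s (b2 s) = 2 ^+ m) ->
  (forall m s, (m + size s = n)%N ->
    energy b1 (fun a => mat_op n k (b1 a)) s m s <= B * 2 ^+ m) ->
  (forall m s, (m + size s = n)%N ->
    energy b2 (fun a => mat_op n kt (b2 a)) s m s <= B * 2 ^+ m) ->
  forall f, dsum n [::] (fun i => cabs (mat_op n k f i) ^+ 2) <=
    C ^+ 2 * dsum n [::] (fun i => cabs (f i) ^+ 2).
Proof.
move=> A0 B1; have B0 : 0 <= B by lra.
pose L : R := 4 * B ^+ 2; pose W : R := 2 * L ^+ 2 + L + A * L ^+ 2.
pose Lam : R := 16 * B + 4 * (L ^+ 2 * (1 + 16 * B)).
pose K : R := 2 * A + 40 * W + (1024 * L ^+ 2 * W + 512 * L ^+ 2).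
pose C : R := 8 * W + K * (1 + 4 * Lam).
have L1 : 1 <= L by rewrite /L; nra.
have W1 : 1 <= W.
  by have := mulr_ge0 A0 (sqr_ge0 L); have := sqr_ge0 L; rewrite /W; lra.
have Lam0 : 0 <= Lam.
  have : 0 <= L ^+ 2 * (1 + 16 * B) by rewrite mulr_ge0 ?sqr_ge0//; lra.
  by rewrite /Lam; lra.
have K0 : 0 <= K.
  have := sqr_ge0 L; have : 0 <= L ^+ 2 * W by rewrite mulr_ge0 ?sqr_ge0//; lra.
  by rewrite /K; lra.
have C0 : 0 < C.
  have : 0 <= K * (1 + 4 * Lam) by rewrite mulr_ge0//; lra.
  by rewrite /C; lra.
exists (2 * C); first by rewrite mulr_ge0// ltW.
move=> n k b1 b2 kt kP b1s b11 b21 e1 e2 f.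
set X := dsum _ _ (fun i => cabs (f i) ^+ 2).
set N := dsum n [::] _.
have N0 : 0 <= N by apply: dsum_ge0 => i; exact: sqr_ge0.
(* With this scale the inequality multiplied by [C] reads N / 2 <= C^2 X + N / 4, whence the factor
   2 in the final constant. *)
pose t := (2 * C)^-1; have t0 : 0 < t by rewrite invr_gt0 mulr_gt0.
have := bilinear_bound A0 B1 kP b1s b11 b21 e1 e2 f
  (fun i => t%:C * conjc (mat_op n k f i)).
rewrite -/L -/W -/Lam -/K -/C -/X.
have pairing p s (u : seq bool -> R[i]) :
    dsum p s (fun i => t%:C * conjc (u i) * u i) =
    (t * dsum p s (fun i => cabs (u i) ^+ 2))%:C.
  elim: p s => [|p IH] s /=; last by rewrite !IH -rmorphD -mulrDr.
  by rewrite -mulrA [conjc _ * _]mulrC mul_conjc -rmorphM.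
rewrite pairing -/N.
rewrite (_ : dsum n [::] (fun i => cabs (t%:C * _) ^+ 2) = t ^+ 2 * N); last first.
  rewrite /N -dsumZ; apply: eq_dsum => i _ _.
  by rewrite cabsM cabs_conj exprMn cabs_real real_normK// num_real.
rewrite cabs_real ger0_norm ?mulr_ge0 ?(ltW t0)// => h.
have := ler_wpM2l (ltW C0) h.
rewrite (_ : C * (t * N) = N / 2); last by rewrite /t; field; rewrite gt_eqF.
rewrite (_ : C * (C * (X + t ^+ 2 * N)) = C ^+ 2 * X + N / 4); last first.
  by rewrite /t; field; rewrite gt_eqF.
by lra.
Qed.

(** * Discretisation *)

Section SquareIntegrable.
Variable R : realType.
Local Notation mu := (@lebesgue_measure R).
Implicit Types (D E : set (measurableTypeR R)) (g : measurableTypeR R -> R[i]).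

(* The same as cmeasurable, for the measurable structure lebesgue_measure lives
   on, which is convertible but not syntactically equal to the one of R. *)
Definition cmeas D g : Prop :=
  measurable_fun D (fun x => complex.Re (g x)) /\
  measurable_fun D (fun x => complex.Im (g x)).

Definition sqint D g : Prop :=
  cmeas D g /\ mu.-integrable D (fun x => (cabs (g x) ^+ 2)%:E).

Definition energy_on D g : R := Rintegral mu D (fun x => cabs (g x) ^+ 2).

Lemma measurable_cabs2 D g : measurable D -> cmeas D g ->
  measurable_fun D (fun x => cabs (g x) ^+ 2).
Proof.
move=> mD [mr mi]; under eq_fun do rewrite cabs_sqr.
by apply: measurable_funD; apply: measurable_funX.
Qed.

Lemma cmeasS D E g : measurable E -> D `<=` E ->
  cmeas E g -> cmeas D g.
Proof. by move=> mE DE [? ?]; split; apply: measurable_funS DE _. Qed.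

Lemma sqintS D E g : measurable D -> measurable E -> D `<=` E ->
  sqint E g -> sqint D g.
Proof.
move=> mD mE DE [mg ig]; split; first exact: cmeasS DE mg.
exact: integrableS mE mD DE ig.
Qed.

Lemma cmeasU D E g : measurable D -> measurable E ->
  cmeas D g -> cmeas E g -> cmeas (D `|` E) g.
Proof. by move=> mD mE [? ?] [? ?]; split; apply/measurable_funU. Qed.

Lemma sqintU D E g : measurable D -> measurable E -> [disjoint D & E] ->
  sqint D g -> sqint E g -> sqint (D `|` E) g.
Proof.
move=> mD mE DE [mg /integrableP[m1 i1]] [mg' /integrableP[m2 i2]].
split; first exact: cmeasU.
apply/integrableP; split; first by apply/measurable_funU.
rewrite ge0_integral_setU//; first exact: lte_add_pinfty.
by apply: measurableT_comp => //; apply/measurable_funU.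
Qed.

Lemma eq_sqint D g g' : measurable D -> (forall x, D x -> g x = g' x) -> sqint D g -> sqint D g'.
Proof.
move=> mD gg' [[mr mi] ig]; split; first split.
- by apply: eq_measurable_fun mr => x /set_mem/gg' ->.
- by apply: eq_measurable_fun mi => x /set_mem/gg' ->.
- by apply: eq_integrable ig => // x /set_mem/gg' ->.
Qed.

Lemma sqint_bounded D g c : measurable D -> (mu D < +oo)%E -> cmeas D g ->
  (forall x, D x -> cabs (g x) <= c) -> sqint D g.
Proof.
move=> mD fD mg gc; split=> //.
apply: (measurable_bounded_integrable (f := fun x => cabs (g x) ^+ 2)) => //.
  exact: measurable_cabs2.
exists (c ^+ 2); split; first exact: num_real.
move=> y cy x Dx /=; rewrite ger0_norm ?sqr_ge0// (le_trans _ (ltW cy))//.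
by rewrite lerXn2r ?nnegrE ?cabs_ge0 ?gc// (le_trans (cabs_ge0 _) (gc _ Dx)).
Qed.

Lemma sqint_cst D (c : R[i]) : measurable D -> (mu D < +oo)%E -> sqint D (fun=> c).
Proof.
by move=> mD fD; apply: (@sqint_bounded _ _ (cabs c)) => //; split.
Qed.

Lemma cmeasZ D g (c : R[i]) : cmeas D g -> cmeas D (fun x => c * g x).
Proof.
move=> [mr mi]; split.
- apply: (@eq_measurable_fun _ _ _ _ _ (fun x => complex.Re c * complex.Re (g x) -
    complex.Im c * complex.Im (g x))).
    by move=> x _; case: (c) (g x) => a b [].
  by apply: measurable_funB; apply: measurable_funM.
- apply: (@eq_measurable_fun _ _ _ _ _ (fun x => complex.Re c * complex.Im (g x) +
    complex.Im c * complex.Re (g x))).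
    by move=> x _; case: (c) (g x) => a b [].
  by apply: measurable_funD; apply: measurable_funM.
Qed.

Lemma cmeasD D g g' : cmeas D g -> cmeas D g' -> cmeas D (fun x => g x + g' x).
Proof.
move=> [mr mi] [mr' mi']; split.
- apply: (@eq_measurable_fun _ _ _ _ _ (fun x => complex.Re (g x) + complex.Re (g' x))).
    by move=> x _; case: (g x) (g' x) => a b [].
  exact: measurable_funD.
- apply: (@eq_measurable_fun _ _ _ _ _ (fun x => complex.Im (g x) + complex.Im (g' x))).
    by move=> x _; case: (g x) (g' x) => a b [].
  exact: measurable_funD.
Qed.

Lemma sqintZ D g (c : R[i]) : measurable D -> sqint D g -> sqint D (fun x => c * g x).
Proof.
move=> mD [mg ig]; split; first exact: cmeasZ.
apply: eq_integrable (integrableZl mD (cabs c ^+ 2) ig) => // x _ /=.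
by rewrite cabsM exprMn EFinM.
Qed.

Lemma sqint_integrable D g : measurable D -> (mu D < +oo)%E -> sqint D g ->
  mu.-integrable D (fun x => (complex.Re (g x))%:E) /\
  mu.-integrable D (fun x => (complex.Im (g x))%:E).
Proof.
move=> mD fD [[mr mi] ig].
have [_ i1] := sqint_cst 1 mD fD.
have i2 : mu.-integrable D (fun x => (1 + cabs (g x) ^+ 2)%:E).
  move: i1; rewrite cabs1 expr1n => i1.
  by apply: eq_integrable (integrableD mD i1 ig).
have le1 (x : R) : `|x| <= 1 + x ^+ 2.
  by have := sqr_ge0 (`|x| - 1); have := sqr_ge0 x; rewrite -(real_normK (num_real x)); lra.
have p1 x : 0 <= 1 + cabs (g x) ^+ 2 by rewrite addr_ge0 ?sqr_ge0.
split; apply: le_integrable i2 => //; try exact/measurable_EFinP.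
- move=> x _; rewrite /= lee_fin (ger0_norm (p1 x)) (le_trans (le1 _))// lerD2l.
  by rewrite cabs_sqr lerDl sqr_ge0.
- move=> x _; rewrite /= lee_fin (ger0_norm (p1 x)) (le_trans (le1 _))// lerD2l.
  by rewrite cabs_sqr lerDr sqr_ge0.
Qed.

Lemma cintegral_setU D E g : measurable D -> measurable E -> [disjoint D & E] ->
  (mu (D `|` E) < +oo)%E -> sqint (D `|` E) g ->
  cintegral (D `|` E) g = cintegral D g + cintegral E g.
Proof.
move=> mD mE DE fDE /sqint_integrable[|//|ir ii]; first exact: measurableU.
by rewrite /cintegral !Rintegral_setU.
Qed.

Lemma energy_setU D E g : measurable D -> measurable E -> [disjoint D & E] ->
  sqint (D `|` E) g ->
  energy_on (D `|` E) g = energy_on D g + energy_on E g.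
Proof. by move=> mD mE DE [_ ig]; rewrite /energy_on Rintegral_setU. Qed.

Lemma eq_cintegral D g g' : (forall x, D x -> g x = g' x) ->
  cintegral D g = cintegral D g'.
Proof.
by move=> gg'; rewrite /cintegral; congr Complex; apply: eq_Rintegral => x /set_mem/gg' ->.
Qed.

Lemma cintegralZ D g (c : R[i]) : measurable D -> (mu D < +oo)%E -> sqint D g ->
  cintegral D (fun x => c * g x) = c * cintegral D g.
Proof.
move=> mD fD /sqint_integrable[]// ir ii; rewrite /cintegral.
have -> : (fun x => complex.Re (c * g x)) =
    (fun x => complex.Re c * complex.Re (g x) - complex.Im c * complex.Im (g x)).
  by apply/funext => x; case: (c) (g x) => a b [].
have -> : (fun x => complex.Im (c * g x)) =
    (fun x => complex.Re c * complex.Im (g x) + complex.Im c * complex.Re (g x)).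
  by apply/funext => x; case: (c) (g x) => a b [].
have z (a : R) (u : measurableTypeR R -> R) :
    mu.-integrable D (fun x => (u x)%:E) ->
    mu.-integrable D (EFin \o (fun x => a * u x)).
  by move=> iu; apply: eq_integrable (integrableZl mD a iu).
rewrite (RintegralB mD (z _ _ ir) (z _ _ ii)) (RintegralD mD (z _ _ ii) (z _ _ ir)).
by rewrite !RintegralZl//; case: c.
Qed.

(** Cauchy-Schwarz, from the nonnegative integral of (u - a)^2 with a the mean of u over [D]. *)
Lemma sqr_Rintegral_le D (u : measurableTypeR R -> R) (h : R) : measurable D -> 0 < h ->
  mu D = h%:E -> mu.-integrable D (EFin \o u) ->
  mu.-integrable D (fun x => (u x ^+ 2)%:E) ->
  Rintegral mu D u ^+ 2 <= h * Rintegral mu D (fun x => u x ^+ 2).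
Proof.
move=> mD h0 muD iu iu2; have fD : (mu D < +oo)%E by rewrite muD ltry.
set I := Rintegral mu D u; set J := Rintegral mu D _.
pose a := I / h.
have iau : mu.-integrable D (fun x => (- (2 * a) * u x)%:E).
  by apply: eq_integrable (integrableZl mD (- (2 * a)) iu).
have ic : mu.-integrable D (fun=> (a ^+ 2)%:E).
  apply: (measurable_bounded_integrable (f := fun=> a ^+ 2)) => //.
  by exists `|a ^+ 2|; split; [exact: num_real|move=> y ay x _ /=; exact: ltW].
have : 0 <= Rintegral mu D (fun x => (u x ^+ 2 + - (2 * a) * u x) + a ^+ 2).
  apply: Rintegral_ge0 => x _.
  by have := sqr_ge0 (u x - a); lra.
rewrite RintegralD//; last first.
  by apply: eq_integrable (integrableD mD iu2 iau).
rewrite RintegralD// RintegralZl// Rintegral_cst// [X in fine X]muD /= -/I -/J.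
rewrite (_ : _ + _ + _ = J - I ^+ 2 / h); last by rewrite /a; field; rewrite gt_eqF.
by rewrite subr_ge0 ler_pdivrMr// mulrC.
Qed.

Lemma jensen_energy D g (h : R) : measurable D -> 0 < h -> mu D = h%:E -> sqint D g ->
  cabs (cintegral D g) ^+ 2 <= h * energy_on D g.
Proof.
move=> mD h0 muD sg; have fD : (mu D < +oo)%E by rewrite muD ltry.
have [ir ii] := sqint_integrable mD fD sg; have [[mr mi] ig] := sg.
have bound (u : measurableTypeR R -> R) : measurable_fun D u ->
    (forall x, u x ^+ 2 <= cabs (g x) ^+ 2) ->
    mu.-integrable D (fun x => (u x ^+ 2)%:E).
  move=> mu_ ug; apply: le_integrable ig => //.
    by apply/measurable_EFinP; exact: measurable_funX.
  by move=> x _; rewrite /= lee_fin !ger0_norm ?sqr_ge0.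
rewrite cabs_sqr /= /energy_on.
have -> : (fun x => cabs (g x) ^+ 2) =
    (fun x => complex.Re (g x) ^+ 2 + complex.Im (g x) ^+ 2).
  by apply/funext => x; rewrite cabs_sqr.
have sq1 x : complex.Re (g x) ^+ 2 <= cabs (g x) ^+ 2.
  by rewrite cabs_sqr lerDl sqr_ge0.
have sq2 x : complex.Im (g x) ^+ 2 <= cabs (g x) ^+ 2.
  by rewrite cabs_sqr lerDr sqr_ge0.
have ir2 := bound _ mr sq1; have ii2 := bound _ mi sq2.
rewrite RintegralD//.
by rewrite mulrDr lerD//; apply: sqr_Rintegral_le.
Qed.

End SquareIntegrable.

(** * Dyadic intervals as nodes of the tree *)

Section DyadicNodes.
Variables (R : realType) (M : nat).
Local Notation mu := (@lebesgue_measure R).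
Let n := (M + M)%N.
Implicit Types (s t i j : seq bool) (g : measurableTypeR R -> R[i]).

(** The path read as a binary number, the step nearest to the root being the most significant
    digit. *)
Fixpoint npos s : int := if s is c :: s' then 2 * npos s' + (c : nat)%:Z else 0.

(** The root is the whole interval of length 2^M, and the leaves at depth 2M are the finest
    intervals. *)
Definition node s : dyadic := Dyadic (npos s) (M%:Z - (size s)%:Z).

Local Notation len s := (dlen R (node s)).

Definition lend s : R := (npos s)%:~R * len s.

Definition cell s : set (measurableTypeR R) := dset R (node s).

Lemma len_gt0 s : 0 < len s.
Proof. by rewrite exprz_gt0. Qed.

Lemma len_cons c s : len (c :: s) = len s / 2.
Proof.
rewrite /dlen /= (_ : _ - _ = M%:Z - (size s)%:Z + -1); last by lia.
by rewrite expfzDr ?pnatr_eq0// exprN1.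
Qed.

Lemma len_node m s : (m + size s = n)%N -> len s = 2 ^+ m / 2 ^+ M.
Proof.
rewrite /n => ms; rewrite /dlen /= (_ : _ - _ = m%:Z + - M%:Z); last by lia.
by rewrite expfzDr ?pnatr_eq0// -invr_expz.
Qed.

Lemma lend_cons c s : lend (c :: s) = lend s + (c : nat)%:R * (len s / 2).
Proof. by rewrite /lend len_cons /= intrD intrM /=; field. Qed.

Lemma cellE s x : cell s x <-> lend s <= x < lend s + len s.
Proof.
by rewrite /cell /dset /= in_itv /= intrD mulrDl mul1r.
Qed.

Lemma cell_lend s : cell s (lend s).
Proof. by apply/cellE; rewrite lexx ltrDl len_gt0. Qed.

Lemma measurable_cell s : measurable (cell s).
Proof. exact: measurable_itv. Qed.

Lemma mu_cell s : mu (cell s) = (len s)%:E.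
Proof.
rewrite /cell /dset lebesgue_measure_itv /= lte_fin intrD mulrDl mul1r.
by rewrite ltrDl len_gt0 EFinN -EFinD addrAC subrr add0r.
Qed.

Lemma mu_cell_fin s : (mu (cell s) < +oo)%E.
Proof. by rewrite mu_cell ltry. Qed.

Lemma cell_split s : cell s = cell (false :: s) `|` cell (true :: s).
Proof.
have l0 := len_gt0 s.
apply/seteqP; split => x.
  move=> /cellE/andP[xs1 xs2]; have [h|h] := ltP x (lend s + len s / 2).
    by left; apply/cellE; rewrite lend_cons len_cons /=; apply/andP; split; lra.
  by right; apply/cellE; rewrite lend_cons len_cons /=; apply/andP; split; lra.
by case=> /cellE/andP[]; rewrite lend_cons len_cons /= => x1 x2;
  apply/cellE/andP; split; lra.
Qed.

Lemma cell_cons c s : cell (c :: s) `<=` cell s.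
Proof. by rewrite (cell_split s); case: c; [right|left]. Qed.

Lemma cell_children_disjoint s : [disjoint cell (false :: s) & cell (true :: s)].
Proof.
apply/disj_setPS => x [/cellE/andP[_ +] /cellE/andP[+ _]].
by rewrite !lend_cons !len_cons /=; lra.
Qed.

Lemma cell_suffix s t : suffix s t -> cell t `<=` cell s.
Proof.
move=> /suffixP[u ->]; elim: u => [|c u IH] //=.
exact: subset_trans (@cell_cons _ _) IH.
Qed.

Lemma cell_nil : cell [::] = `[0, 2 ^+ M[%classic.
Proof.
by rewrite /cell /dset /= /dlen /= subr0 mul0r add0r mul1r.
Qed.

Lemma domain_cell : domain R M = cell [::] `|` [set 2 ^+ M].
Proof.
rewrite cell_nil /domain; apply/seteqP; split => x /=; rewrite !in_itv /=.
  by rewrite [x <= _]le_eqVlt => /andP[x0 /orP[/eqP->|xM]]; [right|left; rewrite x0].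
by case=> [/andP[-> /ltW]//|->]; rewrite lexx exprn_ge0.
Qed.

Lemma cell_domain s : cell s `<=` domain R M.
Proof.
rewrite domain_cell => x xs; left; apply: cell_suffix xs; exact: suffix0s.
Qed.

Lemma node_dyadic s : (size s <= n)%N -> is_dyadic R M (node s).
Proof.
move=> sn; split; last exact: cell_domain.
by move: sn; rewrite /n /=; lia.
Qed.

(** Dyadic intervals are nested or disjoint: climbing from [t] reduces to equal depth, then to two
    children of one node. *)
Lemma cell_meet s t x : (size s <= size t)%N -> cell s x -> cell t x -> suffix s t.
Proof.
elim: t s => [|c t IH] s; first by case: s.
rewrite leq_eqVlt => /orP[/eqP|st xs xt]; last first.
  by apply: suffix_trans (suffix_cons _ _); apply: IH => //; exact: cell_cons xt.
case: s => // d s [st] xs xt.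
have /suffixP[u tE] : suffix s t.
  by apply: IH; rewrite ?st//; [exact: cell_cons xs|exact: cell_cons xt].
have u0 : u = [::].
  apply/size0nil; move/(congr1 size)/eqP: tE.
  by rewrite size_cat -st -{1}[size s]add0n eqn_add2r => /eqP.
rewrite {u}u0 /= in tE; rewrite {}tE {IH t st} in xt *.
have [->|/negP cd] := eqVneq d c; first exact: suffix_refl.
exfalso; move: xs xt => /cellE/andP[x1 x2] /cellE/andP[x3 x4].
move: x1 x2 x3 x4; rewrite !lend_cons !len_cons.
by have := len_gt0 s; case: c d cd => -[]//= _; lra.
Qed.

Lemma cell_disjoint s t : (size s <= size t)%N -> ~~ suffix s t ->
  dset R (node s) `&` dset R (node t) = set0.
Proof.
move=> st nst; apply/seteqP; split => // x [xs xt].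
by move/negP: nst; apply; exact: cell_meet xs xt.
Qed.

Lemma cintegral_dsum m s g : sqint (cell s) g ->
  cintegral (cell s) g = dsum m s (fun i => cintegral (cell i) g).
Proof.
elim: m s => [|m IH] s gs //=.
have gc c : sqint (cell (c :: s)) g.
  exact: sqintS (measurable_cell _) (measurable_cell _) (@cell_cons c s) gs.
rewrite -!IH// cell_split cintegral_setU -?cell_split//; try exact: measurable_cell.
- exact: cell_children_disjoint.
- exact: mu_cell_fin.
Qed.

Lemma energy_dsum m s g : sqint (cell s) g ->
  energy_on (cell s) g = dsum m s (fun i => energy_on (cell i) g).
Proof.
elim: m s => [|m IH] s gs //=.
have gc c : sqint (cell (c :: s)) g.
  exact: sqintS (measurable_cell _) (measurable_cell _) (@cell_cons c s) gs.
rewrite -!IH// cell_split energy_setU -?cell_split//; try exact: measurable_cell.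
exact: cell_children_disjoint.
Qed.

Lemma sqint_leaves m s g :
  (forall i, size i = (m + size s)%N -> suffix s i -> sqint (cell i) g) ->
  sqint (cell s) g.
Proof.
elim: m s => [|m IH] s gi; first by apply: gi; rewrite ?suffix_refl.
have gc c : sqint (cell (c :: s)) g.
  apply: IH => i si ssi; apply: gi; first by rewrite si /= addnS.
  exact: suffix_trans (suffix_cons _ _) ssi.
rewrite cell_split; apply: sqintU => //; try exact: measurable_cell.
exact: cell_children_disjoint.
Qed.

Variable K : R -> R -> R[i].

Definition leaf_const := forall i j x y, size i = n -> size j = n ->
  cell i x -> cell j y -> K x y = K (lend i) (lend j).

(** The factor is the length of a leaf, so that the matrix acts on averages. *)
Definition kmat i j : R[i] := K (lend i) (lend j) * ((2 ^+ M)^-1 : R)%:C.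

(** Test functions need not be constant on leaves, since the Haar functions of the finest tiles
    change sign there; the operator sees only these averages. *)
Definition leaf_avg (f : R -> R[i]) i : R[i] :=
  cintegral (cell i) f * (2 ^+ M : R)%:C.

Lemma len_leaf i : size i = n -> len i = (2 ^+ M)^-1.
Proof. by move=> si; rewrite (@len_node 0) ?add0n// mul1r. Qed.

Lemma kernel_op_leaf f i x : leaf_const -> sqint (cell [::]) f -> size i = n ->
  cell i x -> kernel_op M K f x = mat_op n kmat (leaf_avg f) i.
Proof.
move=> Kc fs si xi.
have fj j : sqint (cell j) f.
  apply: sqintS (measurable_cell _) (measurable_cell _) _ fs.
  by apply: cell_suffix; exact: suffix0s.
have Kf j : size j = n -> sqint (cell j) (fun y => K x y * f y).
  move=> sj; apply: eq_sqint (sqintZ (K (lend i) (lend j)) (measurable_cell j) (fj j)).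
    exact: measurable_cell.
  by move=> y yj; rewrite -(Kc i j x y).
have sq : sqint (cell [::]) (fun y => K x y * f y).
  by apply: (@sqint_leaves n) => j sj _; apply: Kf; rewrite sj addn0.
(* The closed domain exceeds the root cell by a single point. *)
transitivity (cintegral (cell [::]) (fun y => K x y * f y)).
  have [ir ii] := sqint_integrable (measurable_cell _) (mu_cell_fin _) sq.
  move: ir ii; rewrite cell_nil /kernel_op /cintegral /domain => ir ii.
  by rewrite !Rintegral_itv_bndo_bndc.
rewrite (cintegral_dsum n sq) /mat_op; apply: eq_dsum => j sj _.
have {}sj : size j = n by rewrite sj addn0.
rewrite (eq_cintegral (g' := fun y => K (lend i) (lend j) * f y)); last first.
  by move=> y yj; rewrite -(Kc i j x y).
rewrite cintegralZ//; [|exact: measurable_cell|exact: mu_cell_fin].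
by rewrite /kmat /leaf_avg mulrACA -[X in _ = _ * X]rmorphM/= mulVf ?rmorph1 ?mulr1//.
Qed.

End DyadicNodes.

(** * From the kernel to its matrix *)

Section Discretisation.
Variables (R : realType) (M : nat).
Local Notation mu := (@lebesgue_measure R).
Local Notation n := (M + M)%N.
Local Notation cell := (@cell R M).
Local Notation lend := (@lend R M).
Implicit Types (s t i j : seq bool).

Variables (A : R) (K : R -> R -> R[i]).
Hypothesis KP : perfect_dyadic_kernel M A K.

Lemma kernel_const s t x x' y : (size s <= n)%N -> (size t <= n)%N ->
  dset R (node M s) `&` dset R (node M t) = set0 ->
  cell s x -> cell s x' -> cell t y -> K x y = K x' y /\ K y x = K y x'.
Proof.
case: KP => _ _ Kc _ _ sn tn st sx sx' ty.
have := Kc _ _ (node_dyadic R sn) (node_dyadic R tn) st _ _ _ sx sx' ty.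
by move=> /cabs_add_eq0[/subr0_eq -> /subr0_eq ->].
Qed.

Lemma kernel_diag i x y : size i = n -> cell i x -> cell i y -> K x y = 0.
Proof.
case: KP => _ _ _ Kd _ si; apply: Kd; first by apply: node_dyadic; rewrite si.
by rewrite /dlen /= si; congr (_ ^ _); lia.
Qed.

(** On a single leaf the kernel vanishes by (c); two distinct leaves are disjoint, and (b) is
    applied in each variable in turn. *)
Lemma perfect_leaf_const : leaf_const M K.
Proof.
move=> i j x y si sj xi yj; have [ij|ij] := eqVneq i j.
  by subst j; rewrite !(kernel_diag si) //; exact: cell_lend.
have nij : ~~ suffix i j.
  apply: contra ij => /suffixP[u jE]; move/(congr1 size)/eqP: (jE).
  by rewrite size_cat si sj -{1}[n]add0n eqn_add2r jE => /eqP/esym/size0nil ->.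
have ni : (size i <= n)%N by rewrite si.
have nj : (size j <= n)%N by rewrite sj.
have dij : dset R (node M i) `&` dset R (node M j) = set0.
  by apply: cell_disjoint => //; rewrite si sj.
have [-> _] := kernel_const ni nj dij xi (cell_lend _ _ i) yj.
rewrite setIC in dij.
by have [_ ->] := kernel_const nj ni dij yj (cell_lend _ _ j) (cell_lend _ _ i).
Qed.

Lemma perfect_matrix_kmat : perfect_matrix n `|A| (kmat M K).
Proof.
split.
- by move=> i si; rewrite /kmat (kernel_diag si) ?mul0r//; exact: cell_lend.
- move=> s i i' j si si' sj ssi ssi' nsj; rewrite /kmat.
  have sn : (size s <= n)%N by rewrite -si size_suffix.
  have nj : (size j <= n)%N by rewrite sj.
  have sj' : dset R (node M s) `&` dset R (node M j) = set0.
    by apply: cell_disjoint => //; rewrite sj.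
  by have [-> ->] := kernel_const sn nj sj' (cell_suffix ssi (cell_lend _ _ _))
    (cell_suffix ssi' (cell_lend _ _ _)) (cell_lend _ _ _).
- move=> m s c i j ms si sj ci cj.
  have ms' d : (m + size (d :: s) = n)%N by rewrite -ms.
  have sz d : (size (d :: s) <= n)%N by rewrite -(ms' d) leq_addl.
  have disj d : dset R (node M (d :: s)) `&` dset R (node M (~~ d :: s)) = set0.
    have /disj_set2P := @cell_children_disjoint R M s.
    by case: d => //; rewrite setIC.
  have [E1 _] := kernel_const (sz c) (sz (~~ c)) (disj c)
    (cell_suffix ci (cell_lend _ _ _)) (cell_lend _ _ (c :: s))
    (cell_suffix cj (cell_lend _ _ _)).
  have dj' : dset R (node M (~~ c :: s)) `&` dset R (node M (c :: s)) = set0.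
    by rewrite setIC.
  have [_ E2] := kernel_const (sz (~~ c)) (sz c) dj'
    (cell_suffix cj (cell_lend _ _ _)) (cell_lend _ _ (~~ c :: s))
    (cell_lend _ _ (c :: s)).
  rewrite /kmat E1 E2 cabsM cabs_real ger0_norm ?invr_ge0 ?exprn_ge0//.
  have l0 := len_gt0 R M (c :: s).
  (* The sample points are the left endpoints of the two siblings, whose distance is exactly the
     common length. *)
  have dist : `|lend (c :: s) - lend (~~ c :: s)| = dlen R (node M (c :: s)).
    rewrite !lend_cons len_cons; have := len_gt0 R M s => ls.
    case: c {ci cj E1 E2 disj ms sz ms' dj' l0} => /=.
      by rewrite ger0_norm; lra.
    by rewrite ler0_norm; lra.
  have [_ KA _ _ _] := KP.
  have neq : lend (c :: s) != lend (~~ c :: s).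
    by rewrite -subr_eq0 -normr_eq0 dist gt_eqF.
  have := KA _ _ (cell_domain (cell_lend _ _ (c :: s)))
    (cell_domain (cell_lend _ _ (~~ c :: s))) neq.
  rewrite dist (len_node R (ms' c)) => KA'.
  have M0 : 0 < 2 ^+ M :> R by rewrite exprn_gt0.
  have m0 : 0 < 2 ^+ m :> R by rewrite exprn_gt0.
  apply: le_trans (ler_wpM2r _ KA') _; first by rewrite invr_ge0 ltW.
  rewrite (_ : _ / _ / _ = A / 2 ^+ m); last by field; rewrite !gt_eqF.
  by rewrite ler_wpM2r ?ler_norm// invr_ge0 ltW.
Qed.

End Discretisation.

(** * Step functions, leaf averages and test functions *)

Section StepFunctions.
Variables (R : realType) (M : nat).
Local Notation mu := (@lebesgue_measure R).
Local Notation n := (M + M)%N.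
Local Notation cell := (@cell R M).
Implicit Types (s i j : seq bool) (g f : measurableTypeR R -> R[i]).

Lemma step_sqint (v : seq bool -> R[i]) g m s :
  (forall i x, size i = (m + size s)%N -> suffix s i -> cell i x -> g x = v i) ->
  sqint (cell s) g.
Proof.
move=> gv; apply: (@sqint_leaves _ _ m) => i si ssi.
apply: (eq_sqint (measurable_cell _ _) _
  (sqint_cst (v i) (measurable_cell _ _) (mu_cell_fin _ _ _))).
by move=> x xi; rewrite (gv i).
Qed.

Lemma step_energy (v : seq bool -> R[i]) g m s : (m + size s = n)%N ->
  (forall i x, size i = n -> suffix s i -> cell i x -> g x = v i) ->
  energy_on (cell s) g = dsum m s (fun i => cabs (v i) ^+ 2) / 2 ^+ M.
Proof.
move=> ms gv.
have gs : sqint (cell s) g by apply: (@step_sqint v g m s); rewrite ms.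
rewrite (energy_dsum m gs) mulrC -dsumZ; apply: eq_dsum => i si ssi.
have {}si : size i = n by rewrite si.
rewrite /energy_on (@eq_Rintegral _ _ _ _ _ (fun=> cabs (v i) ^+ 2)).
  rewrite Rintegral_cst; last exact: measurable_cell.
  by rewrite [X in fine X]mu_cell /= (len_leaf R si) mulrC.
by move=> x /set_mem xi; rewrite (gv i).
Qed.

Lemma leaf_avg_energy f i : sqint (cell i) f -> size i = n ->
  cabs (leaf_avg M f i) ^+ 2 <= 2 ^+ M * energy_on (cell i) f.
Proof.
move=> fi si.
have := jensen_energy (measurable_cell M i) (len_gt0 R M i) (mu_cell R M i) fi.
have M0 : 0 < 2 ^+ M :> R by rewrite exprn_gt0.
rewrite (len_leaf R si) /leaf_avg cabsM cabs_real ger0_norm ?(ltW M0)// exprMn => h.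
rewrite -(ler_pM2r (x := (2 ^+ M) ^+ 2)) in h; last by rewrite exprn_gt0.
apply: le_trans h _.
by rewrite le_eqVlt; apply/orP; left; apply/eqP; field; rewrite gt_eqF.
Qed.

Lemma leaf_avg_sum m s f : (m + size s = n)%N -> sqint (cell s) f ->
  dsum m s (leaf_avg M f) = cintegral (cell s) f * (2 ^+ M : R)%:C.
Proof.
move=> ms fs; rewrite (cintegral_dsum m fs) mulrC -dsumZ.
by apply: eq_dsum => i _ _; rewrite mulrC.
Qed.

Lemma leaf_avg_dsum_le m s f : (m + size s = n)%N -> sqint (cell s) f ->
  dsum m s (fun i => cabs (leaf_avg M f i) ^+ 2) <= 2 ^+ M * energy_on (cell s) f.
Proof.
move=> ms fs; rewrite (energy_dsum m fs) -dsumZ; apply: ler_dsum => i si ssi.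
apply: leaf_avg_energy; last by rewrite si.
exact: sqintS (measurable_cell _ _) (measurable_cell _ _) (cell_suffix ssi) fs.
Qed.

Definition bounded_meas g : Prop :=
  cmeas setT g /\ exists c : R, forall x, cabs (g x) <= c.

Lemma bounded_measZ g (a : R[i]) : bounded_meas g -> bounded_meas (fun x => a * g x).
Proof.
move=> [mg [c gc]]; split; first exact: cmeasZ.
by exists (cabs a * c) => x; rewrite cabsM ler_wpM2l ?cabs_ge0.
Qed.

Lemma bounded_measD g g' : bounded_meas g -> bounded_meas g' ->
  bounded_meas (fun x => g x + g' x).
Proof.
move=> [mg [c gc]] [mg' [c' gc']]; split; first exact: cmeasD.
by exists (c + c') => x; rewrite (le_trans (cabsD _ _))// lerD.
Qed.

Lemma bounded_meas_dchi (I : dyadic) : bounded_meas (dchi I).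
Proof.
split; first split.
- rewrite /dchi /=; apply: measurable_indic; exact: measurable_itv.
- by rewrite /dchi /=; exact: measurable_cst.
- exists 1 => x; rewrite /dchi cabs_real indicE.
  by case: (_ \in _); rewrite ?normr1 ?normr0.
Qed.

Lemma bounded_meas_span (G : set (R -> R[i])) f : (forall g, G g -> bounded_meas g) ->
  in_span G f -> bounded_meas f.
Proof.
move=> Gb [p [c [g [Gg fE]]]].
have -> : f = (fun x => \sum_(i < p) c i * g i x) by apply/funext.
elim: p c g Gg {fE} => [|p IH] c g Gg.
  under eq_fun do rewrite big_ord0; split; first by split; exact: measurable_cst.
  by exists 0 => x; rewrite cabs0.
under eq_fun do rewrite big_ord_recr /=.
by apply: bounded_measD; [apply: IH => i; exact: Gg|apply/bounded_measZ/Gb].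
Qed.

Lemma test_function_sqint f s : test_function M f -> sqint (cell s) f.
Proof.
move=> tf; have [[mr mi] [c fc]] : bounded_meas f.
  apply: bounded_meas_span tf => g [[P _ <-]|[I _ <-]]; last exact: bounded_meas_dchi.
  apply: bounded_measZ; apply: bounded_measD; first exact: bounded_meas_dchi.
  under eq_fun do rewrite -mulN1r.
  by apply: bounded_measZ; exact: bounded_meas_dchi.
apply: (@sqint_bounded _ _ _ c) => //; [exact: measurable_cell|exact: mu_cell_fin|].
by split; [apply: measurable_funS mr|apply: measurable_funS mi].
Qed.

End StepFunctions.

(** * The space L^2 and energies on the tree *)

Section L2.
Variables (R : realType) (M : nat).
Local Notation mu := (@lebesgue_measure R).
Local Notation n := (M + M)%N.
Local Notation cell := (@cell R M).
Local Notation dom := (domain R M : set (measurableTypeR R)).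
Implicit Types (f g : measurableTypeR R -> R[i]).

Lemma measurable_domain : measurable dom.
Proof. exact: measurable_itv. Qed.

Lemma sqint_set1 (x : R) g : sqint ([set x] : set (measurableTypeR R)) g.
Proof.
apply: (@sqint_bounded _ _ _ (cabs (g x))).
- exact: measurable_set1.
- by rewrite lebesgue_measure_set1.
- by split; exact: measurable_fun_set1.
- by move=> y ->.
Qed.

Lemma sqint_domain g : sqint (cell [::]) g -> sqint dom g.
Proof.
move=> gs; rewrite domain_cell; apply: sqintU => //.
- exact: measurable_cell.
- apply/disj_setPS => x [xc xM]; move: xc; rewrite xM cell_nil /= in_itv /=.
  by move=> /andP[_]; rewrite ltxx.
- exact: sqint_set1.
Qed.

Lemma sqint_domain_cell g s : sqint dom g -> sqint (cell s) g.
Proof.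
apply: sqintS; [exact: measurable_cell|exact: measurable_domain|exact: cell_domain].
Qed.

Lemma energy_domain g : sqint dom g -> energy_on dom g = energy_on (cell [::]) g.
Proof.
move=> gs; have [_] := sqint_domain_cell [::] gs.
rewrite /energy_on cell_nil => gi.
by rewrite (Rintegral_itv_bndo_bndc gi).
Qed.

Lemma energy_ereal (D : set (measurableTypeR R)) g : measurable D -> sqint D g ->
  (\int[mu]_(x in D) (cabs (g x) ^+ 2)%:E)%E = (energy_on D g)%:E.
Proof. by move=> mD [_ gi]; rewrite fineK// integrable_fin_num. Qed.

Lemma energy_on_ge0 D g : 0 <= energy_on D g.
Proof. by apply: Rintegral_ge0 => x _; exact: sqr_ge0. Qed.

Lemma L2normE f :
  L2norm M f = poweR (\int[mu]_(x in dom) (cabs (f x) ^+ 2)%:E)%E 2^-1.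
Proof.
rewrite /L2norm unlock; congr (poweR _ _).
rewrite [RHS]integral_mkcond; apply: eq_integral => x _.
rewrite /patch; case: ifP => _ /=.
  by rewrite ger0_norm ?cabs_ge0// powR_mulrn ?cabs_ge0.
by rewrite normr0 powR0.
Qed.

Lemma L2norm_sqint f : sqint dom f ->
  L2norm M f = (Num.sqrt (energy_on (cell [::]) f))%:E.
Proof.
move=> fs; rewrite L2normE (energy_ereal measurable_domain fs) poweR_EFin energy_domain//.
by rewrite powR12_sqrt// energy_on_ge0.
Qed.

Lemma in_L2P f : in_L2 M f <-> sqint dom f.
Proof.
split=> [[[mr mi] foo]|fs]; last first.
  by split; [case: (fs)|rewrite L2norm_sqint// ltry].
have mf : cmeas dom f by split.
split=> //; apply/integrableP; split.
  by apply/measurable_EFinP; apply: measurable_cabs2 mf; exact: measurable_domain.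
under eq_integral do rewrite /= ger0_norm ?sqr_ge0//.
rewrite ltNge; apply/negP; rewrite leye_eq => /eqP E.
by move: foo; rewrite L2normE E poweRyr.
Qed.

Lemma leaf_avg_supp f s i : (size s <= size i)%N -> ~~ suffix s i ->
  (forall x, ~ dset R (node M s) x -> f x = 0) -> leaf_avg M f i = 0.
Proof.
move=> si nsi f0; rewrite /leaf_avg (eq_cintegral (g' := fun=> 0)); last first.
  move=> x xi; apply: f0 => xs; move/negP: nsi; apply.
  exact: (cell_meet (M := M) si xs xi).
have -> : cintegral (cell i) (fun=> 0) = 0 :> R[i]; last exact: mul0r.
by rewrite /cintegral /= Rintegral_cst ?mul0r//; exact: measurable_cell.
Qed.

(** The truncation makes the support condition of [local_Tb_matrix] hold for paths of every length;
    for instance a proper ancestor of [s] may have a nonzero average. On leaves nothing changes when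
    f is supported in [s]. *)
Definition node_avg f s i : R[i] := if suffix s i then leaf_avg M f i else 0.

Lemma node_avg_leaf f s i : (size s <= n)%N -> size i = n ->
  (forall x, ~ dset R (node M s) x -> f x = 0) -> node_avg f s i = leaf_avg M f i.
Proof.
move=> sn si f0; rewrite /node_avg; case: ifPn => // nsi.
by rewrite (leaf_avg_supp _ nsi f0)// si.
Qed.

Lemma kernel_op_sqint K f s : leaf_const M K -> sqint (cell [::]) f ->
  (size s <= n)%N -> sqint (cell s) (kernel_op M K f).
Proof.
move=> Kc fs sn; apply: (@step_sqint R M (mat_op n (kmat M K) (leaf_avg M f)) _
  (n - size s)) => i x; rewrite subnK// => si _.
exact: kernel_op_leaf.
Qed.

Lemma kernel_op_energy K f m s : leaf_const M K -> sqint (cell [::]) f ->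
  (m + size s = n)%N -> energy_on (cell s) (kernel_op M K f) =
  dsum m s (fun i => cabs (mat_op n (kmat M K) (leaf_avg M f) i) ^+ 2) / 2 ^+ M.
Proof.
by move=> Kc fs ms; apply: step_energy => // i x si _; exact: kernel_op_leaf.
Qed.

(** Jensen's inequality handles f, while the image depends on f only through its leaf averages. The
    factor 2^M converts integrals into sums over leaves. *)
Lemma node_avg_energy K f m s : leaf_const M K -> sqint (cell [::]) f ->
  (m + size s = n)%N -> (forall x, ~ dset R (node M s) x -> f x = 0) ->
  dsum m s (fun i => cabs (node_avg f s i) ^+ 2 +
    cabs (mat_op n (kmat M K) (node_avg f s) i) ^+ 2) <=
  2 ^+ M * (energy_on (cell s) f + energy_on (cell s) (kernel_op M K f)).
Proof.
move=> Kc fs ms f0; have sn : (size s <= n)%N by rewrite -ms leq_addl.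
have M0 : 0 < 2 ^+ M :> R by rewrite exprn_gt0.
have E i : mat_op n (kmat M K) (node_avg f s) i = mat_op n (kmat M K) (leaf_avg M f) i.
  apply: eq_dsum => j sj _; rewrite node_avg_leaf//.
  by rewrite sj addn0.
rewrite dsumD mulrDr lerD//.
  rewrite (@eq_dsum _ _ _ _ (fun i => cabs (leaf_avg M f i) ^+ 2)).
    apply: leaf_avg_dsum_le => //.
    exact: sqintS (measurable_cell _ _) (measurable_cell _ _)
      (cell_suffix (suffix0s s)) fs.
  by move=> i si _; rewrite node_avg_leaf// si.
rewrite (kernel_op_energy Kc fs ms) mulrC divfK ?gt_eqF//.
by under eq_fun do rewrite E.
Qed.

End L2.

Theorem theorem6p8 (R : realType) (A B : R) :
  exists C : R,
  forall (M : nat) (M_gt0 : (0 < M)%N) (K : R -> R -> R[i])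
    (K_cz : perfect_dyadic_kernel M A K)
    (b1 b2 : tile R -> R -> R[i])
    (b_test : forall P, Pplus M P ->
       test_function_on M (tile_int P) (b1 P) /\
       test_function_on M (tile_int P) (b2 P))
    (b_avg : forall P, Pplus M P ->
       avg (tile_int P) (b1 P) = 1 /\ avg (tile_int P) (b2 P) = 1)
    (b_bound : forall P, Pplus M P ->
       (\int[lebesgue_measure]_(x in dset R (tile_int P))
          (cabs (b1 P x) ^+ 2 + cabs (kernel_op M K (b1 P) x) ^+ 2 +
           cabs (b2 P x) ^+ 2 +
           cabs (kernel_op M (adjoint_kernel K) (b2 P) x) ^+ 2)%:E
        <= (B * dlen R (tile_int P))%:E)%E),
  forall f : R -> R[i], in_L2 M f ->
    in_L2 M (kernel_op M K f) /\
    (L2norm M (kernel_op M K f) <= C%:E * L2norm M f)%E.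
Proof.
(* Neither [A] nor [B] is assumed positive, so the matrix theorem is applied with the absolute value
   of [A] and with [Num.max B 1]. *)
have B1 : 1 <= Num.max B 1 by rewrite le_max lexx orbT.
have [C C0 Tb] := local_Tb_matrix (normr_ge0 A) B1.
exists C => M _ K K_cz b1 b2 b_test b_avg b_bound f /in_L2P fL2.
set n := (M + M)%N.
have M0 : 0 < 2 ^+ M :> R by rewrite exprn_gt0.
have Kc := perfect_leaf_const K_cz.
have Kc' : leaf_const M (adjoint_kernel K).
  by move=> i j x y si sj xi yj; exact: Kc.
pose T s := lacunary_tile R (node M s).
have TP m s : (m + size s = n)%N -> Pplus M (T s).
  by move=> ms; exists (node M s) => //; apply: node_dyadic; rewrite -/n -ms leq_addl.
have sq1 m s p : (m + size s = n)%N -> sqint (cell M p) (b1 (T s)).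
  by move=> ms; have [[tf _] _] := b_test _ (TP _ _ ms); exact: test_function_sqint tf.
have sq2 m s p : (m + size s = n)%N -> sqint (cell M p) (b2 (T s)).
  by move=> ms; have [_ [tf _]] := b_test _ (TP _ _ ms); exact: test_function_sqint tf.
have total m s : (m + size s = n)%N ->
    energy_on (cell M s) (b1 (T s)) + energy_on (cell M s) (kernel_op M K (b1 (T s))) +
    (energy_on (cell M s) (b2 (T s)) +
     energy_on (cell M s) (kernel_op M (adjoint_kernel K) (b2 (T s)))) <=
    B * (2 ^+ m / 2 ^+ M).
  move=> ms; have sn : (size s <= n)%N by rewrite -ms leq_addl.
  have := b_bound _ (TP _ _ ms).
  rewrite /= -lee_fin -(len_node R ms) => /(le_trans _); apply.
  have [_ i1] := sq1 _ _ s ms; have [_ i2] := sq2 _ _ s ms.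
  have [_ i3] := kernel_op_sqint Kc (sq1 _ _ [::] ms) sn.
  have [_ i4] := kernel_op_sqint Kc' (sq2 _ _ [::] ms) sn.
  have mc := @measurable_cell R M s.
  pose e1 x := cabs (b1 (T s) x) ^+ 2.
  pose e2 x := cabs (b2 (T s) x) ^+ 2.
  pose e3 x := cabs (kernel_op M K (b1 (T s)) x) ^+ 2.
  pose e4 x := cabs (kernel_op M (adjoint_kernel K) (b2 (T s)) x) ^+ 2.
  have i13 : lebesgue_measure.-integrable (cell M s) (EFin \o (fun x => e1 x + e3 x)).
    by apply: eq_integrable (integrableD mc i1 i3).
  have i132 : lebesgue_measure.-integrable (cell M s)
      (EFin \o (fun x => e1 x + e3 x + e2 x)).
    by apply: eq_integrable (integrableD mc i13 i2).
  have i1324 : lebesgue_measure.-integrable (cell M s)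
      (EFin \o (fun x => e1 x + e3 x + e2 x + e4 x)).
    by apply: eq_integrable (integrableD mc i132 i4).
  have E := RintegralD mc i132 i4.
  rewrite (RintegralD mc i13 i2) (RintegralD mc i1 i3) -addrA in E.
  by rewrite /energy_on -E fineK ?(integrable_fin_num mc i1324).
have avg1 (b : tile R -> R -> R[i]) m s : (m + size s = n)%N ->
    avg (tile_int (T s)) (b (T s)) = 1 -> sqint (cell M s) (b (T s)) ->
    dsum m s (node_avg M (b (T s)) s) = 2 ^+ m.
  move=> ms a1 bs.
  rewrite (@eq_dsum _ _ _ _ (leaf_avg M (b (T s)))); last first.
    by move=> i _ ssi; rewrite /node_avg ssi.
  rewrite (leaf_avg_sum ms bs); move: a1; rewrite /avg /= -/(cell M s).
  move=> /(congr1 (fun z => (dlen R (node M s))%:C * z)).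
  rewrite mulrA -rmorphM mulfV ?gt_eqF ?len_gt0// rmorph1 mul1r mulr1 => ->.
  rewrite (len_node R ms) -rmorphM divfK ?gt_eqF//.
  by rewrite rmorphXn/= rmorphMn/=.
have M1 : B <= Num.max B 1 by rewrite le_max lexx.
have fl : sqint (cell M [::]) f by exact: sqint_domain_cell.
have main := Tb n (kmat M K) (fun s => node_avg M (b1 (T s)) s)
  (fun s => node_avg M (b2 (T s)) s) (perfect_matrix_kmat K_cz) _ _ _ _ _
  (leaf_avg M f).
have en m s (x y : R) : (m + size s = n)%N -> 0 <= y ->
    x + y <= B * (2 ^+ m / 2 ^+ M) -> 2 ^+ M * x <= Num.max B 1 * 2 ^+ m.
  move=> ms y0 xy; have xB : x <= B * (2 ^+ m / 2 ^+ M) by lra.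
  apply: (@le_trans _ _ (B * 2 ^+ m)); last by rewrite ler_wpM2r// exprn_ge0.
  have := ler_wpM2l (ltW M0) xB; congr (_ <= _); field.
  by rewrite gt_eqF.
have {}main : dsum n [::] (fun i => cabs (mat_op n (kmat M K) (leaf_avg M f) i) ^+ 2) <=
    C ^+ 2 * dsum n [::] (fun i => cabs (leaf_avg M f i) ^+ 2).
  apply: main.
  - by move=> s j nsj; rewrite /node_avg (negPf nsj).
  - move=> m s ms; apply: avg1 => //; last exact: sq1 ms.
    by have [] := b_avg _ (TP _ _ ms).
  - move=> m s ms; apply: avg1 => //; last exact: sq2 ms.
    by have [] := b_avg _ (TP _ _ ms).
  - move=> m s ms; have [[_ b0] _] := b_test _ (TP _ _ ms).
    apply: le_trans (node_avg_energy Kc (sq1 _ _ [::] ms) ms b0) _.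
    by apply: en ms _ (total _ _ ms); rewrite addr_ge0 ?energy_on_ge0.
  (* The matrix of [adjoint_kernel K] is by conversion the transpose of that of [K]. *)
  - move=> m s ms; have [_ [_ b0]] := b_test _ (TP _ _ ms).
    apply: le_trans (node_avg_energy Kc' (sq2 _ _ [::] ms) ms b0) _.
    have tot := total _ _ ms; rewrite addrC in tot.
    by apply: en ms _ tot; rewrite addr_ge0 ?energy_on_ge0.
have n0 : (n + size ([::] : seq bool) = n)%N by rewrite addn0.
have Tf : sqint (domain R M) (kernel_op M K f).
  by apply: sqint_domain; exact: kernel_op_sqint.
split; first exact/in_L2P.
rewrite !L2norm_sqint// -EFinM lee_fin.
rewrite -[X in X * _](ger0_norm C0) -sqrtr_sqr -sqrtrM ?sqr_ge0// ler_wsqrtr//.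
(* The image is constant on leaves, so its energy is exactly that of the matrix image; for f,
   passing to leaf averages only decreases the energy. *)
rewrite (kernel_op_energy Kc fl n0) ler_pdivrMr// (le_trans main)//.
rewrite -[leRHS]mulrA ler_wpM2l ?sqr_ge0// [leRHS]mulrC.
exact: leaf_avg_dsum_le.
Qed.
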